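(* Let $\mu$ be a positive Borel measure on $\mathbb C$ satisfying condition (M), that is, $\int_{\mathbb C}\big|\mathrm e^{\overline z w/2}\big|^2\mathrm e^{-|w|^2/2}\,d\mu(w)<+\infty$ for all $z\in\mathbb C$. If the Toeplitz operator $T_\mu$ is bounded on the Fock space $\mathcal F^2$, then $T_\mu$ is invertible on $\mathcal F^2$ if and only if $\mu$ is a reverse Carleson measure for $\mathcal F^2$.
   Context: $dA=\frac1\pi dx\,dy$ and $d\lambda(z)=\frac12\mathrm e^{-|z|^2/2}dA(z)$ on $\mathbb C$. The Fock space $\mathcal F^2$ is the Hilbert space of entire functions in $L^2(\mathbb C,d\lambda)$, with inner product $\langle f,g\rangle_{\mathcal F^2}=\int_{\mathbb C}f\overline g\,d\lambda$ and reproducing kernel $K_z(w)=\mathrm e^{\overline z w/2}$. For $\mu$ satisfying condition (M), the Toeplitz operator $T_\mu f(z)=\frac12\int_{\mathbb C}f(w)\,\mathrm e^{z\overline w/2}\,\mathrm e^{-|w|^2/2}\,d\mu(w)$, $z\in\mathbb C$, is defined on a dense subspace of $\mathcal F^2$ (the linear span of the reproducing kernels); $T_\mu$ is bounded on $\mathcal F^2$ if it extends to a bounded operator on $\mathcal F^2$, again denoted $T_\mu$. $\mu$ is a reverse Carleson measure for $\mathcal F^2$ if there is a constant $C>0$ with $\int_{\mathbb C}|f(w)|^2\mathrm e^{-|w|^2/2}d\mu(w)\geqslant C\int_{\mathbb C}|f(w)|^2\mathrm e^{-|w|^2/2}dA(w)$ for all $f\in\mathcal F^2$. *)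

(* Defs.v *)
From HB Require Import structures.
From mathcomp Require Import all_boot all_order all_algebra.
From mathcomp Require Import complex.
From mathcomp Require Import all_classical all_reals all_analysis measurable_realfun.
From mathcomp Require Import lra.

Set Implicit Arguments.
Unset Strict Implicit.
Unset Printing Implicit Defensive.

Import Order.TTheory GRing.Theory Num.Theory numFieldNormedType.Exports.
Import ComplexField.Normc.

Local Open Scope classical_set_scope.
Local Open Scope ring_scope.
Local Open Scope complex_scope.

(* [R[i]] as a normed space over itself, so that [derivable f z 1] is complex
   differentiability, with its Borel sigma-algebra. *)
HB.instance Definition _ (R : realType) := GRing.ComAlgebra.copy R[i] R[i]^o.
HB.instance Definition _ (R : realType) := Vector.copy R[i] R[i]^o.
HB.instance Definition _ (R : realType) := NormedModule.copy R[i] R[i]^o.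
HB.instance Definition _ (R : realType) :=
  Measurable.copy R[i] (g_sigma_algebraType (@open R[i])).

Section plane.
Variable R : realType.
Implicit Types z w : R[i].

Lemma normc_le_ReIm z : normc z <= `|complex.Re z| + `|complex.Im z|.
Proof.
case: z => a b /=.
rewrite -(@ler_pXn2r _ 2) ?nnegrE ?sqrtr_ge0 ?addr_ge0//.
rewrite sqr_sqrtr ?addr_ge0 ?sqr_ge0// sqrrD !real_normK ?num_real//.
by rewrite lerD2r lerDl mulrn_wge0// mulr_ge0.
Qed.

Lemma normc_ge0 z : 0 <= normc z.
Proof. by case: z => a b; exact: sqrtr_ge0. Qed.

Lemma open_complexP (U : set R[i]) z : open U -> U z ->
  exists2 e : R, 0 < e & forall w, normc (w - z) < e -> U w.
Proof.
move=> oU Uz; have /nbhs_ballP[e /= e0 zeU] : nbhs z U by exact: open_nbhs_nbhs.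
move: e0 zeU; case: e => e i /=; rewrite ltcE/= => /andP[/eqP-> e0] zeU.
exists e => // w wz; apply: zeU.
by rewrite -ball_normE/= distrC normc_def ltcR -[w - z]/(w - z); case: (w - z) wz.
Qed.

Definition complex_of_pair (p : R * R) : R[i] := p.1 +i* p.2.

Lemma measurable_complex_of_pair : measurable_fun setT complex_of_pair.
Proof.
apply: (@measurability _ _ _ _ _ _ (@open R[i])) => //.
move=> _ [U oU <-]; rewrite setTI.
pose sq (q : rat * rat * nat) : set (R * R) :=
  ball (ratr q.1.1 : R) q.2.+1%:R^-1 `*` ball (ratr q.1.2 : R) q.2.+1%:R^-1.
have -> : complex_of_pair @^-1` U =
    \bigcup_(q in [set q | sq q `<=` complex_of_pair @^-1` U]) sq q.
  apply/seteqP; split=> [[x y] /= Uxy|p [q /= qU qp]]; last exact: qU.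
  have [e e0 eU] := open_complexP oU Uxy.
  have [n ne] : exists n : nat, n.+1%:R^-1 < e / 4.
    have e40 : 0 < e / 4 by rewrite divr_gt0.
    have := @near_infty_natSinv_lt R (PosNum e40).
    by case=> n _ /(_ n (leqnn n)); exists n.
  have n0 : 0 < n.+1%:R^-1 :> R by rewrite invr_gt0.
  have [q1] : exists q : rat, `|ratr q - x| < n.+1%:R^-1.
    have /rat_in_itvoo[q] : x - n.+1%:R^-1 < x + n.+1%:R^-1.
      by rewrite ltrBlDr -addrA ltrDl addr_gt0.
    by rewrite in_itv/= -ltr_distl; exists q.
  have [q2] : exists q : rat, `|ratr q - y| < n.+1%:R^-1.
    have /rat_in_itvoo[q] : y - n.+1%:R^-1 < y + n.+1%:R^-1.
      by rewrite ltrBlDr -addrA ltrDl addr_gt0.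
    by rewrite in_itv/= -ltr_distl; exists q.
  move=> q2y q1x; exists (q1, q2, n) => //= -[a b]; rewrite /sq/= /ball/=.
  move=> [q1a q2b]; apply: eU.
  rewrite (le_lt_trans (normc_le_ReIm _))//=.
  have ax : `|a - x| < e / 4 + e / 4.
    rewrite (le_lt_trans (ler_distD (ratr q1) _ _))// ltrD//.
      by rewrite distrC (lt_trans q1a).
    exact: lt_trans ne.
  have bY : `|b - y| < e / 4 + e / 4.
    rewrite (le_lt_trans (ler_distD (ratr q2) _ _))// ltrD//.
      by rewrite distrC (lt_trans q2b).
    exact: lt_trans ne.
  by rewrite (lt_le_trans (ltrD ax bY))//; lra.
rewrite bigcup_mkcond; apply: countable_bigcupT_measurable => [|q]; first exact: countableP.
case: ifPn => // _; by apply: measurableX; apply: open_measurable; apply: ball_open; rewrite invr_gt0.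
Qed.

End plane.

Section area.
Variable R : realType.
Local Notation leb := (@lebesgue_measure R).

Definition dxdy : set R[i] -> \bar R :=
  pushforward (leb \x leb)%E (@complex_of_pair R).

Fact mcomplex_of_pair :
  @measurable_fun _ _ (measurableTypeR R * measurableTypeR R)%type _
    setT (@complex_of_pair R).
Proof. exact: measurable_complex_of_pair. Qed.

HB.instance Definition _ := Measure.copy dxdy
  (measure_function_pushforward__canonical__measure_function_Measure
    (leb \x leb)%E mcomplex_of_pair).

Fact pi_inv_ge0 : 0 <= (pi : R)^-1. Proof. by rewrite invr_ge0 pi_ge0. Qed.

Definition area : set R[i] -> \bar R := mscale (NngNum pi_inv_ge0) dxdy.

HB.instance Definition _ := Measure.on area.

End area.

Section complex_functions.
Variable R : realType.
Implicit Types (f g : R[i] -> R[i]) (z w : R[i]).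

Definition cexp z : R[i] :=
  let: x +i* y := z in (expR x * cos y) +i* (expR x * sin y).

Definition cintegral d (T : measurableType d) (mu : {measure set T -> \bar R})
    (f : T -> R[i]) : R[i] :=
  (\int[mu]_x complex.Re (f x)) +i* (\int[mu]_x complex.Im (f x)).

Definition gauss w : R := expR (- (normc w ^+ 2) / 2).

Definition gauss_sqint (mu : {measure set R[i] -> \bar R}) f : \bar R :=
  (\int[mu]_w (normc (f w) ^+ 2 * gauss w)%:E)%E.

Definition entire f := forall z, derivable f z 1.

(* The density with respect to [area] of the measure lambda. *)
Definition fock_weight w : R := gauss w / 2.

Definition in_fock : {pred R[i] -> R[i]} := [pred f |
  `[< entire f /\
      (\int[@area R]_w (normc (f w) ^+ 2 * fock_weight w)%:E < +oo)%E >]].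

Lemma measurable_continuousC (h : R[i] -> R) :
  continuous h -> measurable_fun setT h.
Proof.
move=> ch; apply: (measurability _ (RGenOpens.measurableE R)) => //.
move=> _ [_ [a [b ->] <-]]; rewrite setTI; apply: sub_sigma_algebra.
by move/continuousP : ch; apply; exact: interval_open.
Qed.

Lemma lip1_continuousC (h : R[i] -> R) :
  (forall z w, `|h z - h w| <= normc (z - w)) -> continuous h.
Proof.
move=> hl z; apply/(@cvgrPdist_lt _ _ _ (nbhs z)) => e e0.
apply/nbhs_ballP; exists e%:C => [|w]; first by rewrite /= ltcR.
rewrite -ball_normE/= normc_def ltcR => zw.
apply: le_lt_trans (hl z w) _.
by rewrite -[z - w]/(z - w); case: (z - w) zw.
Qed.

Lemma normcD z w : normc (z + w) <= normc z + normc w.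
Proof.
have := ler_normD z w; rewrite !normc_def -rmorphD/= lecR.
by case: z w => [a b] [c d].
Qed.

Lemma normcN z : normc (- z) = normc z.
Proof. by case: z => a b /=; rewrite !sqrrN. Qed.

Lemma continuous_normc : continuous (@normc R).
Proof.
apply: lip1_continuousC => z w; rewrite ler_distl lerBlDr; apply/andP; split.
  by rewrite -(normcN (z - w)) opprB -{1}(subrK z w) (le_trans (normcD _ _))// addrC.
by rewrite -{1}(subrK w z) (le_trans (normcD _ _))// addrC.
Qed.

Lemma entire_continuous f : entire f -> continuous f.
Proof. by move=> ef z; apply/differentiable_continuous/derivable1_diffP. Qed.

Lemma gauss_ge0 w : 0 <= gauss w. Proof. exact: expR_ge0. Qed.

Lemma fock_weight_ge0 w : 0 <= fock_weight w.
Proof. by rewrite divr_ge0// gauss_ge0. Qed.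

Lemma measurable_gauss : measurable_fun setT gauss.
Proof.
apply: (@measurableT_comp _ _ _ _ _ _ (@expR R)) => //.
apply: measurable_funM => //; apply: measurableT_comp => //; apply: measurable_funX.
by apply: measurable_continuousC; exact: continuous_normc.
Qed.

Lemma measurable_fock_density f : entire f ->
  measurable_fun setT (fun w => (normc (f w) ^+ 2 * fock_weight w)%:E).
Proof.
move=> ef; apply/measurable_EFinP; apply: measurable_funM.
  apply: measurable_funX; apply: measurable_continuousC => z.
  by apply: continuous_comp; [exact: entire_continuous|exact: continuous_normc].
by apply: measurable_funM => //; exact: measurable_gauss.
Qed.

Lemma in_fock_submod_closed : submod_closed in_fock.
Proof.
split.
  apply/asboolP; split=> [z|]; first exact: derivable_cst.
  rewrite (eq_integral (fun=> 0%E)) ?integral0// => w _.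
  have -> : (0 : R[i] -> R[i]) w = 0 by [].
  by rewrite normc0 expr0n/= mul0r.
move=> a f g /asboolP[ef f2] /asboolP[eg g2]; apply/asboolP.
have efg : entire (a *: f + g).
  by move=> z; apply: derivableD (eg z); exact: derivableZ.
split => //.
pose F h w := (normc (h w) ^+ 2 * fock_weight w)%:E.
have mF h k : entire h -> measurable_fun setT (fun w => k%:E * F h w)%E.
  by move=> eh; apply: measurable_funeM; exact: measurable_fock_density eh.
pose c := 2 * normc a ^+ 2.
have F0 h w : (0 <= F h w)%E by rewrite lee_fin mulr_ge0 ?sqr_ge0 ?fock_weight_ge0.
have c0 : 0 <= c by rewrite mulr_ge0 ?sqr_ge0.
apply: (@le_lt_trans _ _
    (\int[@area R]_w (c%:E * F f w + 2%:E * F g w))%E).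
  apply: ge0_le_integral => //.
  - by move=> w _; exact: F0.
  - exact: measurable_fock_density efg.
  - by apply: emeasurable_funD; exact: mF.
  - move=> w _; rewrite /F -!EFinM -EFinD lee_fin.
    rewrite (mulrA c) (mulrA 2) -mulrDl.
    rewrite ler_wpM2r ?fock_weight_ge0//.
    have h := normcD ((a *: f) w) (g w).
    have -> : (a *: f + g) w = (a *: f) w + g w by [].
    apply: (@le_trans _ _ ((normc ((a *: f) w) + normc (g w)) ^+ 2)).
      by rewrite ler_pXn2r ?nnegrE ?addr_ge0 ?normc_ge0.
    rewrite [(a *: f) w]/(a * f w) normcM /c -mulrA -exprMn.
    by have := sqr_ge0 (normc a * normc (f w) - normc (g w)); nra.
have cF0 h k : 0 <= k -> forall w, setT w -> (0 <= k%:E * F h w)%E.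
  by move=> k0 w _; apply: mule_ge0; [rewrite lee_fin|exact: F0].
have m1F h : entire h -> measurable_fun setT (F h).
  by move=> eh; exact: measurable_fock_density eh.
rewrite ge0_integralD//; [|exact: cF0|exact: mF|exact: cF0|exact: mF].
rewrite !ge0_integralZl//; [|exact: m1F|exact: m1F].
by rewrite lte_add_pinfty// lte_mul_pinfty// ?lee_fin.
Qed.

HB.instance Definition _ :=
  GRing.isSubmodClosed.Build _ _ in_fock in_fock_submod_closed.

End complex_functions.

Record fock (R : realType) := Fock {
  fock_fun :> R[i] -> R[i]; _ : fock_fun \in @in_fock R }.

HB.instance Definition _ (R : realType) := [isSub for @fock_fun R].
HB.instance Definition _ (R : realType) := [Choice of fock R by <:].
HB.instance Definition _ (R : realType) :=
  [SubChoice_isSubLmodule of fock R by <:].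

Section toeplitz.
Variable R : realType.
Implicit Types (f g : fock R) (z w : R[i]) (mu : {measure set R[i] -> \bar R}).
Implicit Types T : {linear fock R -> fock R}.

Definition fock_inner f g : R[i] :=
  cintegral (@area R) (fun w => f w * (g w)^* * (fock_weight w)%:C).

Definition fock_norm f : R := Num.sqrt (complex.Re (fock_inner f f)).

Definition fock_kernel z w : R[i] := cexp (z^* * w / 2).

(* Linear combinations of kernels, each summand given as (coefficient, point). *)
Definition kernel_span : set (R[i] -> R[i]) := [set h |
  exists s : seq (R[i] * R[i]), h = fun w => \sum_(p <- s) p.1 * fock_kernel p.2 w].

Definition condition_M mu := forall z, (gauss_sqint mu (fock_kernel z) < +oo)%E.

Definition toeplitz mu (h : R[i] -> R[i]) z : R[i] :=
  2^-1 * cintegral mu (fun w => h w * cexp (z * w^* / 2) * (gauss w)%:C).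

(* Bounded extensions are unique because [kernel_span] is dense, so a bounded
   [T] with this property is the operator T_mu on the whole Fock space. *)
Definition toeplitz_extension mu T :=
  forall f, kernel_span f -> forall z, T f z = toeplitz mu f z.

Definition bounded_operator T :=
  exists M : R, forall f, fock_norm (T f) <= M * fock_norm f.

Definition invertible_operator T :=
  exists S : {linear fock R -> fock R},
    [/\ bounded_operator S, cancel T S & cancel S T].

Definition reverse_carleson mu :=
  exists2 C : R, 0 < C & forall f,
    (C%:E * gauss_sqint (@area R) f <= gauss_sqint mu f)%E.

End toeplitz.

(* Main.v *)
Require Import Defs.
From HB Require Import structures.
From mathcomp Require Import all_boot all_order all_algebra.
From mathcomp Require Import complex.
From mathcomp Require Import all_classical all_reals all_analysis measurable_realfun.
From mathcomp Require Import ring lra.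

(** Pairing [T_mu f] with the reproducing kernels gives
    [<T_mu f, g> = 1/2 int f conj(g) e^{-|w|^2/2} dmu] on the span of the
    kernels, so a bounded [T_mu] is a positive operator and the reverse
    Carleson inequality says [<T_mu f, f> >= c |f|^2].  Density of the span and
    Fatou's lemma for [mu] carry this to the whole space.  For a bounded positive
    operator, bounded below is equivalent to invertible: in one direction
    [|T f|^2 <= |T| <T f, f>] by Cauchy-Schwarz for the form of [T], in the
    other the range is closed and has trivial orthogonal complement.

    The Hilbert space theory rests on the reproducing formula
    [f(b) = <f, K_b>].  Translation by [b] reduces it to
    [int g dlambda = g(0)] for entire [g]; averaging over rotations, this is the
    mean value property on circles, which is Goursat's theorem for [g o exp] on
    a rectangle of height [2 pi].  Completeness also follows from the
    reproducing formula: an L^2 limit of elements of the space is its own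
    Bargmann projection, hence entire. *)

Set Implicit Arguments.
Unset Strict Implicit.
Unset Printing Implicit Defensive.

Import Order.TTheory GRing.Theory Num.Theory numFieldNormedType.Exports.
Import ComplexField.Normc.

Local Open Scope classical_set_scope.
Local Open Scope complex_scope.
Local Open Scope ring_scope.

Local Notation Re := complex.Re.
Local Notation Im := complex.Im.

(** * Complex derivatives *)

Section modulus.
Variable R : realType.
Implicit Types z w : R[i].

(** Two obstacles shape the proof. Off the kernel span [gauss_sqint mu f] is not known in advance to
    be finite, and Fatou's lemma bounds an integral of a limit only from above, whereas the reverse
    Carleson inequality asks for a lower bound on it. Fatou is therefore applied to differences
    [v n - v m] inside the span, and the lower bound follows from a triangle inequality. In the
    other direction the reverse Carleson inequality is used on the span alone. The second obstacle
    is integration over circles. Polar coordinates are replaced by Fubini on [0, 2 pi] times the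
    plane, which needs rotations to preserve [area]; this is reduced to shears, hence to
    translations of the line. The normalisations agree: the weight of the Fock norm is half of
    [gauss] and [toeplitz] carries the factor 1/2, so for [f] in the span both [gauss_sqint]
    integrals are twice the Hilbert space quantities |f|^2 and <T f, f>, and a reverse Carleson
    constant is a coercivity constant for [T]. *)

Lemma normrcE z : `|z| = (normc z)%:C.
Proof. by case: z => a b; rewrite normc_def. Qed.

Lemma normc_sqr z : normc z ^+ 2 = Re z ^+ 2 + Im z ^+ 2.
Proof. by case: z => a b /=; rewrite sqr_sqrtr// addr_ge0 ?sqr_ge0. Qed.

Lemma ler_Re_normc z : `|Re z| <= normc z.
Proof.
rewrite -(@ler_pXn2r _ 2) ?nnegrE ?normc_ge0// normc_sqr real_normK ?num_real//.
by rewrite lerDl sqr_ge0.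
Qed.

Lemma ler_Im_normc z : `|Im z| <= normc z.
Proof.
rewrite -(@ler_pXn2r _ 2) ?nnegrE ?normc_ge0// normc_sqr real_normK ?num_real//.
by rewrite lerDr sqr_ge0.
Qed.

Lemma normc_real (x : R) : normc x%:C = `|x|.
Proof. by rewrite /= expr0n addr0 sqrtr_sqr. Qed.

Lemma normc_subC z w : normc (z - w) = normc (w - z).
Proof. by rewrite -normcN opprB. Qed.

Lemma ler_normcB z w : `|normc z - normc w| <= normc (z - w).
Proof.
rewrite ler_distl lerBlDr; apply/andP; split.
  by rewrite -(normcN (z - w)) opprB -{1}(subrK z w) (le_trans (normcD _ _))// addrC.
by rewrite -{1}(subrK w z) (le_trans (normcD _ _))// addrC.
Qed.

End modulus.

Section complex_derivative.
Variable R : realType.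
Implicit Types (f g : R[i] -> R[i]) (z w : R[i]).

(** Complex differentiability without division by [w - z] and with real tolerances, which suits norm
    estimates better than limits in the partially ordered field [R[i]]. *)
Definition cderivative f z (L : R[i]) := forall e : R, 0 < e ->
  exists2 d : R, 0 < d & forall w, normc (w - z) < d ->
    normc (f w - f z - L * (w - z)) <= e * normc (w - z).

Lemma derivable_cderivative f z : derivable f z 1 -> exists L, cderivative f z L.
Proof.
move=> df; exists ('D_1 f z) => e e0.
have /cvgrPdist_le /(_ (e%:C)) := df; rewrite ltcR => /(_ e0).
(* A positive element of [R[i]] has zero imaginary part, so the radius of the ball is real. *)
move=> /nbhs_ballP[[d i] /=]; rewrite ltcE/= => /andP[/eqP -> d0] H.
exists d => // w wz.
have [->|wz0] := eqVneq w z; first by rewrite !subrr mulr0 subrr normc0 mulr0.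
have := H (w - z); rewrite -ball_normE/= sub0r normrN normrcE ltcR => /(_ wz).
rewrite subr_eq0 => /(_ wz0); rewrite normrcE lecR.
rewrite [_ *: 1]mulr1 subrK => h.
have nwz : 0 < normc (w - z).
  rewrite lt_neqAle normc_ge0 andbT eq_sym; apply/eqP => /eq0_normc/eqP.
  by rewrite subr_eq0 (negbTE wz0).
have -> : f w - f z - 'D_1 f z * (w - z) =
    - ('D_1 f z - (w - z)^-1 * (f w - f z)) * (w - z).
  by field; rewrite subr_eq0.
by rewrite normcM normcN ler_wpM2r// normc_ge0.
Qed.

Lemma cderivative_derivable f z L : cderivative f z L -> derivable f z 1.
Proof.
move=> df; apply/cvg_ex; exists L; apply/cvgrPdist_le => -[e i].
rewrite ltcE/= => /andP[/eqP -> e0].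
have [d d0 H] := df e e0.
apply/nbhs_ballP; exists d%:C => /=; first by rewrite ltcR.
move=> h; rewrite -ball_normE/= sub0r normrN normrcE ltcR => hd h0.
rewrite normrcE lecR.
have := H (h + z); rewrite addrK => /(_ hd) {}H.
have nh : 0 < normc h.
  by rewrite lt_neqAle normc_ge0 andbT eq_sym; apply/eqP => /eq0_normc/eqP;
    rewrite (negbTE h0).
rewrite -(ler_pM2r nh) -normcM [_ *: 1]mulr1 -normcN.
suff -> : - ((L - h^-1 *: (f (h + z) - f z)) * h) = f (h + z) - f z - L * h by [].
have -> : h^-1 *: (f (h + z) - f z) = h^-1 * (f (h + z) - f z) by [].
by field.
Qed.

(** Reduces differentiability to a second-order Taylor bound on the unit ball. It serves for [cexp]
    and for differentiation under the integral sign. *)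
Lemma cderivative_quadratic f z L (C : R) :
  (forall h, normc h <= 1 -> normc (f (z + h) - f z - h * L) <= C * normc h ^+ 2) ->
  cderivative f z L.
Proof.
move=> H e e0; set D := `|C| + 1; have D0 : 0 < D by rewrite ltr_wpDl.
exists (Num.min 1 (e / D)) => [|w]; first by rewrite lt_min ltr01 divr_gt0.
rewrite lt_min => /andP[w1 wD]; have := H (w - z) (ltW w1).
rewrite [z + _]addrC subrK [_ * L]mulrC => /le_trans; apply; rewrite expr2 mulrA.
rewrite ler_wpM2r ?normc_ge0//; move: wD; rewrite ltr_pdivlMr// => wD.
apply: le_trans (ltW wD); rewrite mulrC ler_wpM2l ?normc_ge0//.
by rewrite (le_trans (ler_norm _))// lerDl.
Qed.

Lemma entireP f : entire f <-> forall z, exists L, cderivative f z L.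
Proof.
split=> [ef z|ef z]; first exact/derivable_cderivative/ef.
by have [L] := ef z; exact: cderivative_derivable.
Qed.

End complex_derivative.

(** * Elementary bounds for sine, cosine and the real exponential *)

Section trigonometric_bounds.
Variable R : realType.
Implicit Types x y : R.

Lemma ler_norm_sin y : `|sin y| <= `|y|.
Proof.
wlog y0 : y / 0 <= y.
  move=> H; case: (leP 0 y) => [/H//|y0].
  by rewrite -normrN -sinN -(normrN y) H// oppr_ge0 ltW.
have [c _] := @MVT_segment R sin cos 0 y y0 (fun x _ => is_derive_sin x)
  (continuous_subspaceT (@continuous_sin R)).
rewrite sin0 !subr0 => ->; rewrite normrM ler_piMl//; exact: cos_max.
Qed.

Lemma ler_norm_cosB1 y : `|cos y - 1| <= y ^+ 2.
Proof.
wlog y0 : y / 0 <= y.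
  move=> H; case: (leP 0 y) => [/H//|y0].
  by rewrite -cosN -(sqrrN y) H// oppr_ge0 ltW.
have [c] := @MVT_segment R cos (fun x => - sin x) 0 y y0 (fun x _ => is_derive_cos x)
  (continuous_subspaceT (@continuous_cos R)).
rewrite in_itv/= => /andP[c0 cy]; rewrite cos0 !subr0 => ->.
rewrite normrM normrN expr2 (ger0_norm y0) ler_wpM2r//.
by rewrite (le_trans (ler_norm_sin c))// ger0_norm.
Qed.

Lemma ler_norm_sinB y : `|sin y - y| <= 2 * y ^+ 2.
Proof.
wlog y0 : y / 0 <= y.
  move=> H; case: (leP 0 y) => [/H//|y0].
  have -> : sin y - y = - (sin (- y) - - y) by rewrite sinN; ring.
  by rewrite normrN -(sqrrN y) H// oppr_ge0 ltW.
(* Beyond 1 the trivial bound [1 + y] is already below [2 * y ^+ 2]. *)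
have [y1|y1] := leP y 1; last first.
  have s1 := sin_le1 y; have s2 := sin_geN1 y.
  by rewrite ler_norml; apply/andP; split; nra.
have [c] := @MVT_segment R sin cos 0 y y0 (fun x _ => is_derive_sin x)
  (continuous_subspaceT (@continuous_sin R)).
rewrite in_itv/= => /andP[c0 cy]; rewrite sin0 !subr0 => ->.
rewrite -{2}(mul1r y) -mulrBl normrM (ger0_norm y0) expr2 mulrA ler_wpM2r//.
apply: le_trans (ler_norm_cosB1 c) _; have c1 : c <= 1 by exact: le_trans y1.
by have := sqr_ge0 c; nra.
Qed.

(** Both sides are the inequality [1 + x <= expR x], taken at [x] and, multiplied by [expR x], at
    [- x]. *)
Lemma expRB1_bounds x : x <= expR x - 1 <= x * expR x.
Proof.
apply/andP; split; first by have := expR_ge1Dx x; lra.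
have := expR_ge1Dx (- x); have := expRxMexpNx_1 x; have := expR_gt0 x.
by nra.
Qed.

Lemma ler_norm_expRB1 x : `|expR x - 1| <= `|x| * expR `|x|.
Proof.
have /andP[h1 h2] := expRB1_bounds x.
have [x0|x0] := leP 0 x; first by rewrite !ger0_norm//; lra.
rewrite (ltr0_norm x0); have := expR_ge1Dx (- x).
have e1 : expR x < 1 by rewrite expR_lt1.
by rewrite ler_norml => e2; apply/andP; split; nra.
Qed.

Lemma ler_norm_expRB1B x : `|expR x - 1 - x| <= x ^+ 2 * expR `|x|.
Proof.
have /andP[h1 h2] := expRB1_bounds x.
have -> : `|expR x - 1 - x| = expR x - 1 - x by rewrite ger0_norm//; lra.
apply: (@le_trans _ _ (x * (expR x - 1))); first by lra.
apply: le_trans (ler_norm _) _; rewrite normrM -real_normK ?num_real// expr2 -mulrA.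
by rewrite ler_wpM2l// ler_norm_expRB1.
Qed.

End trigonometric_bounds.

(** * The complex exponential and closure properties of entire functions *)

Section complex_exponential.
Variable R : realType.
Implicit Types (f g : R[i] -> R[i]) (z w h : R[i]).

Lemma cexpD z w : cexp (z + w) = cexp z * cexp w.
Proof.
case: z w => [a b] [c d]; rewrite /cexp /= expRD cosD sinD.
by apply/eqP; rewrite eq_complex /=; apply/andP; split; apply/eqP; ring.
Qed.

Lemma cexp0 : cexp (0 : R[i]) = 1.
Proof. by rewrite /cexp/= expR0 cos0 sin0 mulr1 mulr0. Qed.

Lemma conj_cexp z : (cexp z)^* = cexp z^*.
Proof. by case: z => a b; rewrite /cexp/= cosN sinN mulrN. Qed.

Lemma normc_cexp z : normc (cexp z) = expR (Re z).
Proof.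
case: z => a b /=; rewrite !exprMn -mulrDr cos2Dsin2 mulr1 sqrtr_sqr.
by rewrite ger0_norm// expR_ge0.
Qed.

Lemma normc_cexp_le z : normc (cexp z) <= expR (normc z).
Proof.
by rewrite normc_cexp ler_expR (le_trans (ler_norm _))// ler_Re_normc.
Qed.

(** With n = |h|, the real part contributes n^2 e^n and the imaginary part at most 3 n^2 e^n, whence
    the constant 4. *)
Lemma cexp_taylor h : normc (cexp h - 1 - h) <= 4 * normc h ^+ 2 * expR (normc h).
Proof.
have hx := ler_Re_normc h; have hy := ler_Im_normc h; have h2 := normc_sqr h.
case: h hx hy h2 => x y; move: (normc (x +i* y)) (normc_ge0 (x +i* y)) => n n0 hx hy h2.
rewrite /= in hx hy h2.
apply: le_trans (normc_le_ReIm _) _ => /=; rewrite oppr0 !addr0 ?subr0.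
have ex : expR x <= expR n by rewrite ler_expR (le_trans (ler_norm _)).
have eax : expR `|x| <= expR n by rewrite ler_expR.
have e0 := expR_gt0 x; set E := expR n in ex eax *.
have E0 : 0 < E by exact: expR_gt0.
have -> : expR x * cos y - 1 - x = (expR x - 1 - x) + expR x * (cos y - 1) by ring.
have -> : expR x * sin y - y = expR x * (sin y - y) + (expR x - 1) * y by ring.
have H1 : `|expR x - 1 - x| <= x ^+ 2 * E.
  by rewrite (le_trans (ler_norm_expRB1B x))// ler_wpM2l// sqr_ge0.
have H2 : `|expR x * (cos y - 1)| <= E * y ^+ 2.
  by rewrite normrM (gtr0_norm e0) ler_pM ?(ltW e0)// ler_norm_cosB1.
have H3 : `|expR x * (sin y - y)| <= E * (2 * y ^+ 2).
  by rewrite normrM (gtr0_norm e0) ler_pM ?(ltW e0)// ler_norm_sinB.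
have H4 : `|(expR x - 1) * y| <= n * E * n.
  rewrite normrM ler_pM//; apply: le_trans (ler_norm_expRB1 x) _.
  by rewrite ler_pM// ?expR_ge0.
have H5 := ler_normD (expR x - 1 - x) (expR x * (cos y - 1)).
have H6 := ler_normD (expR x * (sin y - y)) ((expR x - 1) * y).
have x2 := sqr_ge0 x; have y2 := sqr_ge0 y; nra.
Qed.

Lemma cderivative_cexp z : cderivative (@cexp R) z (cexp z).
Proof.
apply: (@cderivative_quadratic _ _ _ _ (normc (cexp z) * (4 * expR 1))) => h h1.
have -> : cexp (z + h) - cexp z - h * cexp z = cexp z * (cexp h - 1 - h).
  by rewrite cexpD; ring.
rewrite normcM -mulrA ler_wpM2l ?normc_ge0//.
apply: le_trans (cexp_taylor h) _.
rewrite mulrAC ler_wpM2r ?sqr_ge0// ler_wpM2l// ?ler_expR//.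
Qed.

Lemma entire_cexp : entire (@cexp R).
Proof. by apply/entireP => z; exists (cexp z); exact: cderivative_cexp. Qed.

Lemma entire_cst c : entire (fun=> c : R[i]).
Proof. by move=> z; exact: derivable_cst. Qed.

Lemma entire_id : entire (fun z : R[i] => z).
Proof. by move=> z; exact: derivable_id. Qed.

Lemma entireD f g : entire f -> entire g -> entire (fun z => f z + g z).
Proof. by move=> ef eg z; exact: (derivableD (ef z) (eg z)). Qed.

Lemma entireM f g : entire f -> entire g -> entire (fun z => f z * g z).
Proof. by move=> ef eg z; exact: (derivableM (ef z) (eg z)). Qed.

Lemma entire_comp f g : entire f -> entire g -> entire (fun z => f (g z)).
Proof.
move=> ef eg z; apply/derivable1_diffP.
apply: (@differentiable_comp _ _ _ _ g f); exact/derivable1_diffP.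
Qed.

Lemma entire_affine (a b : R[i]) : entire (fun z => a * z + b).
Proof.
have ea : entire (fun z => a * z).
  exact: (@entireM (fun=> a) (fun z => z) (@entire_cst a) (@entire_id)).
exact: (@entireD (fun z => a * z) (fun=> b) ea (@entire_cst b)).
Qed.


End complex_exponential.

(** * Goursat's theorem and the mean value property *)

Section segment_integral.
Variable R : realType.
Local Notation leb := (@lebesgue_measure R).
Implicit Types (f : R -> R) (a b m : R).

Definition segint a b f : R := \int[leb]_(x in `[a, b]) f x.

Lemma continuous_segint f a b : continuous f -> leb.-integrable `[a, b] (EFin \o f).
Proof.
move=> cf; apply: continuous_compact_integrable; first exact: segment_compact.
exact: continuous_subspaceT.
Qed.

Lemma segint_split f a m b : continuous f -> a <= m -> m <= b ->
  segint a b f = segint a m f + segint m b f.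
Proof.
move=> cf am mb; apply/eqP; rewrite addrC -subr_eq; apply/eqP.
rewrite /segint Rintegral_itvB//; last exact: continuous_segint.
apply: Rintegral_itv_obnd_cbnd.
by apply: integrableS (continuous_segint m b cf) => //; exact: subset_itv_oc_cc.
Qed.

Lemma segintB f g a b : continuous f -> continuous g ->
  segint a b f - segint a b g = segint a b (fun x => f x - g x).
Proof. by move=> cf cg; rewrite /segint RintegralB//; exact: continuous_segint. Qed.

(** Used twice: for the linear approximation on a small rectangle in Goursat's theorem, and for a
    circle shrinking to its centre. *)
Lemma segint_near f a b (k e : R) : continuous f -> a <= b ->
  (forall x, a <= x <= b -> `|f x - k| <= e) ->
  `|segint a b f - k * (b - a)| <= e * (b - a).
Proof.
move=> cf ab H.
have Hk r : segint a b (cst r) = r * (b - a).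
  rewrite /segint Rintegral_cst//= lebesgue_measure_itv/= lte_fin.
  by case: ltgtP ab => //= -> _; rewrite subrr.
have cc r : continuous (cst r : R -> R) by move=> ?; exact: cvg_cst.
rewrite -Hk -(Hk e) segintB//.
have cd : continuous (fun x => f x - k) by move=> x; apply: cvgB => //;
  [exact: cf|exact: cvg_cst].
apply: le_trans (le_normr_Rintegral _ _) _ => //; first exact: continuous_segint.
apply: le_Rintegral => //.
- by apply: continuous_segint => x; exact: (cvg_norm (cd x)).
- exact: continuous_segint.
Qed.

End segment_integral.

(** Every right end bounds every left end, so the supremum of the left ends lies in all the
    segments. *)
Lemma nested_segments (R : realType) (s W : nat -> R) :
  (forall n, 0 <= W n) -> (forall n, s n <= s n.+1) ->
  (forall n, s n.+1 + W n.+1 <= s n + W n) ->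
  exists x, forall n, s n <= x <= s n + W n.
Proof.
move=> W0 s1 s2.
have mono m n : (m <= n)%N -> s m <= s n.
  by move=> /subnK <-; elim: (n - m)%N => // k IH; rewrite addSn (le_trans IH).
have anti m n : (m <= n)%N -> s n + W n <= s m + W m.
  by move=> /subnK <-; elim: (n - m)%N => // k IH; rewrite addSn (le_trans (s2 _)).
have bd m n : s m <= s n + W n.
  have [mn|nm] := leqP m n; first by rewrite (le_trans (mono _ _ mn))// lerDl.
  by apply: le_trans (anti _ _ (ltnW nm)); rewrite lerDl.
exists (sup (range s)) => n; apply/andP; split.
  apply: ub_le_sup; last by exists n.
  by exists (s 0%N + W 0%N) => _ [m _ <-].
apply: ge_sup; first by exists (s 0%N); exists 0%N.
by move=> _ [m _ <-].
Qed.

Section goursat.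
Variable R : realType.
Implicit Types (h : R[i] -> R[i]) (a b c d : R).

Lemma entire_near h (z : R[i]) (e : R) : entire h -> 0 < e ->
  exists2 d : R, 0 < d & forall w, normc (w - z) < d -> normc (h w - h z) < e.
Proof.
move=> eh e0; have /cvgrPdist_lt/(_ e%:C) := @entire_continuous _ _ eh z.
rewrite ltcR => /(_ e0) /nbhs_ballP[[d i] /=]; rewrite ltcE/= => /andP[/eqP -> d0] H.
exists d => // w wz; have := H w.
by rewrite -ball_normE/= !normrcE !ltcR => K; rewrite normc_subC; apply: K;
  rewrite normc_subC.
Qed.

(** The Lipschitz condition covers the horizontal and the vertical sides of a rectangle at once. *)
Lemma continuous_curve h (p : R -> R[i]) : entire h ->
  (forall x y, normc (p x - p y) <= `|x - y|) ->
  continuous (fun x => Re (h (p x))) /\ continuous (fun x => Im (h (p x))).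
Proof.
move=> eh pl; split=> x; apply/cvgrPdist_lt => e e0;
  have [d d0 H] := entire_near (p x) eh e0; near=> y;
  have /H {}H : normc (p y - p x) < d
    by (apply: le_lt_trans (pl _ _) _; rewrite distrC; near: y; exact: cvgr_dist_lt).
  rewrite distrC; apply: le_lt_trans H; apply: le_trans (ler_Re_normc _).
  by case: (h (p y)) (h (p x)) => [? ?] [? ?].
rewrite distrC; apply: le_lt_trans H; apply: le_trans (ler_Im_normc _).
by case: (h (p y)) (h (p x)) => [? ?] [? ?].
Unshelve. all: by end_near. Qed.

Lemma normc_horizontal (x y c : R) : normc ((x +i* c) - (y +i* c)) <= `|x - y|.
Proof. by rewrite /= subrr expr0n addr0 sqrtr_sqr. Qed.

Lemma normc_vertical (x y a : R) : normc ((a +i* x) - (a +i* y)) <= `|x - y|.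
Proof. by rewrite /= subrr expr0n add0r sqrtr_sqr. Qed.

(* The real part of the integral of [h] along the boundary of the rectangle
   [a, b] x [c, d]; the imaginary part is minus that of ['i h]. *)
Definition rectint h a b c d : R :=
  segint a b (fun x => Re (h (x +i* c))) - segint a b (fun x => Re (h (x +i* d)))
  - segint c d (fun y => Im (h (b +i* y))) + segint c d (fun y => Im (h (a +i* y))).

Lemma rectint_split h a m b c n d : entire h ->
  a <= m -> m <= b -> c <= n -> n <= d ->
  rectint h a b c d = rectint h a m c n + rectint h m b c n +
    rectint h a m n d + rectint h m b n d.
Proof.
move=> eh am mb cn nd; rewrite /rectint.
have ch c0 := (continuous_curve eh (fun x y => normc_horizontal x y c0)).1.
have cv a0 := (continuous_curve eh (fun x y => normc_vertical x y a0)).2.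
rewrite (segint_split (ch c) am mb) (segint_split (ch d) am mb).
rewrite (segint_split (cv b) cn nd) (segint_split (cv a) cn nd).
by ring.
Qed.

(** Opposite sides are paired. The linear part of [h] contributes [ga * (b - a) * (d - c)] to both
    pairs, with opposite signs, and cancels. What remains is an error of [2 * e * p] per unit
    length, where [p] is half the perimeter. *)
Lemma rectint_small h z L (e : R) : entire h -> cderivative h z L -> 0 < e ->
  exists2 r : R, 0 < r & forall a b c d,
    a <= Re z <= b -> c <= Im z <= d -> (b - a) + (d - c) < r ->
    `|rectint h a b c d| <= 2 * e * ((b - a) + (d - c)) ^+ 2.
Proof.
move=> eh dh e0; have [r r0 H] := dh e e0; exists r => // a b c d.
case: z L H {dh} => x0 y0 [al ga] H /= /andP[ax xb] /andP[cy yd] pr.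
set p := b - a + (d - c) in pr *.
have ch c0 := (continuous_curve eh (fun x y => normc_horizontal x y c0)).1.
have cv a0 := (continuous_curve eh (fun x y => normc_vertical x y a0)).2.
have K x y : a <= x <= b -> c <= y <= d ->
    `|Re (h (x +i* y)) - (Re (h (x0 +i* y0)) + al * (x - x0) - ga * (y - y0))| <=
      e * p /\
    `|Im (h (x +i* y)) - (Im (h (x0 +i* y0)) + al * (y - y0) + ga * (x - x0))| <= e * p.
  move=> /andP[ax' xb'] /andP[cy' yd'].
  have wz : normc ((x +i* y) - (x0 +i* y0)) <= p.
    apply: le_trans (normc_le_ReIm _) _ => /=; apply: lerD; rewrite ler_norml;
      apply/andP; split; lra.
  have := H (x +i* y) (le_lt_trans wz pr).
  move=> /le_trans/(_ (ler_wpM2l (ltW e0) wz)) N.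
  split; (apply: le_trans N).
    apply: le_trans (ler_Re_normc _); rewrite le_eqVlt; apply/orP; left; apply/eqP;
      congr `| _ |.
    by case: (h (x +i* y)) (h (x0 +i* y0)) => [? ?] [? ?] /=; ring.
  apply: le_trans (ler_Im_normc _); rewrite le_eqVlt; apply/orP; left; apply/eqP;
    congr `| _ |.
  by case: (h (x +i* y)) (h (x0 +i* y0)) => [? ?] [? ?] /=; ring.
have ab : a <= b by exact: le_trans xb.
have cd : c <= d by exact: le_trans yd.
have cc : c <= c <= d by rewrite lexx.
have dd : c <= d <= d by rewrite lexx andbT.
have aa : a <= a <= b by rewrite lexx.
have bb : a <= b <= b by rewrite lexx andbT.
have S1 : `|segint a b (fun x => Re (h (x +i* c)) - Re (h (x +i* d))) -
    (ga * (d - c)) * (b - a)| <= 2 * e * p * (b - a).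
  apply: segint_near => // [x|x xab]; first by apply: cvgB; exact: ch.
  have [+ _] := K x c xab cc; have [+ _] := K x d xab dd.
  by rewrite !ler_norml => /andP[? ?] /andP[? ?]; apply/andP; split; lra.
have S2 : `|segint c d (fun y => Im (h (b +i* y)) - Im (h (a +i* y))) -
    (ga * (b - a)) * (d - c)| <= 2 * e * p * (d - c).
  apply: segint_near => // [y|y ycd]; first by apply: cvgB; exact: cv.
  have [_ +] := K b y bb ycd; have [_ +] := K a y aa ycd.
  by rewrite !ler_norml => /andP[? ?] /andP[? ?]; apply/andP; split; lra.
have -> : rectint h a b c d =
    segint a b (fun x => Re (h (x +i* c)) - Re (h (x +i* d))) -
    segint c d (fun y => Im (h (b +i* y)) - Im (h (a +i* y))).
  rewrite -(segintB _ _ (ch c) (ch d)) -(segintB _ _ (cv b) (cv a)) /rectint; ring.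
move: S1 S2; rewrite !ler_norml => /andP[? ?] /andP[? ?].
have -> : 2 * e * p ^+ 2 = 2 * e * p * (b - a) + 2 * e * p * (d - c) by rewrite /p;
  ring.
by apply/andP; split; lra.
Qed.

Lemma rectint_quarter h a b c d (k : R) : entire h -> a <= b -> c <= d ->
  k <= `|rectint h a b c d| -> exists p : R * R,
    [/\ a <= p.1 <= a + (b - a) / 2, c <= p.2 <= c + (d - c) / 2 &
        k / 4 <= `|rectint h p.1 (p.1 + (b - a) / 2) p.2 (p.2 + (d - c) / 2)|].
Proof.
move=> eh ab cd; pose m := a + (b - a) / 2; pose n := c + (d - c) / 2.
have am : a <= m by rewrite /m; lra.
have mb : m <= b by rewrite /m; lra.
have cn : c <= n by rewrite /n; lra.
have nd : n <= d by rewrite /n; lra.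
rewrite (rectint_split eh am mb cn nd).
have mE : m + (b - a) / 2 = b by rewrite /m; field.
have nE : n + (d - c) / 2 = d by rewrite /n; field.
move=> H.
have [q1|q1] := leP (k / 4) `|rectint h a m c n|.
  by exists (a, c); split=> //=; rewrite lexx.
have [q2|q2] := leP (k / 4) `|rectint h m b c n|.
  by exists (m, c); rewrite /= mE; split; rewrite ?am ?lexx.
have [q3|q3] := leP (k / 4) `|rectint h a m n d|.
  by exists (a, n); rewrite /= nE; split; rewrite ?cn ?lexx.
have [q4|q4] := leP (k / 4) `|rectint h m b n d|.
  by exists (m, n); rewrite /= mE nE; split; rewrite ?cn ?am ?lexx.
exfalso; move: H; apply/negP; rewrite -ltNge.
have -> : k = k / 4 + k / 4 + k / 4 + k / 4 by field.
do 3 (apply: le_lt_trans (ler_normD _ _) _; apply: ltrD => //).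
Qed.

Lemma goursat h a b c d : entire h -> a < b -> c < d -> rectint h a b c d = 0.
Proof.
move=> eh ab cd; apply/eqP; rewrite -normr_le0 leNgt; apply/negP => k0.
set k := `|_| in k0.
pose W n := (b - a) / 2 ^+ n; pose H n := (d - c) / 2 ^+ n.
have W0 n : 0 < W n by rewrite divr_gt0 ?exprn_gt0// subr_gt0.
have H0 n : 0 < H n by rewrite divr_gt0 ?exprn_gt0// subr_gt0.
have WS n : W n.+1 = W n / 2 by rewrite /W exprS; field; rewrite expf_neq0.
have HS n : H n.+1 = H n / 2 by rewrite /H exprS; field; rewrite expf_neq0.
pose P n (p : R * R) := k / 4 ^+ n <= `|rectint h p.1 (p.1 + W n) p.2 (p.2 + H n)|.
(* The hypothesis [P] is placed under the existential, so that [choice] yields a total function from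
   which the corners can be iterated. *)
have step (np : nat * (R * R)) : exists q : R * R, P np.1 np.2 ->
    [/\ np.2.1 <= q.1 <= np.2.1 + W np.1.+1, np.2.2 <= q.2 <=
      np.2.2 + H np.1.+1 & P np.1.+1 q].
  case: np => n p /=; have [Pn|nP] := pselect (P n p); last by exists p.
  have pW : p.1 <= p.1 + W n by rewrite lerDl ltW.
  have pH : p.2 <= p.2 + H n by rewrite lerDl ltW.
  have [q] := rectint_quarter eh pW pH Pn.
  rewrite !(addrAC _ _ (- _)) !subrr !add0r -WS -HS => -[q1 q2 q3].
  exists q => _; split=> //; rewrite /P (le_trans _ q3)// exprS.
  by rewrite le_eqVlt; apply/orP; left; apply/eqP; field; rewrite expf_neq0.
have [f fP] := choice step.
pose s := fix s n := if n is m.+1 then f (m, s m) else (a, c).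
have sP n : P n (s n).
  elim: n => [|n IH]; last by have [] := fP (n, s n) IH.
  by rewrite /P /= /W /H !expr0 !divr1 !subrKC.
have sS n := fP (n, s n) (sP n).
have [x xP] : exists x, forall n, (s n).1 <= x <= (s n).1 + W n.
  apply: nested_segments => n; first exact: ltW.
    by have [/andP[]] := sS n.
  have [/andP[_ q] _ _] := sS n; apply: le_trans (lerD q (lexx (W n.+1))) _.
  by rewrite -addrA lerD2l !WS -splitr.
have [y yP] : exists y, forall n, (s n).2 <= y <= (s n).2 + H n.
  apply: nested_segments => n; first exact: ltW.
    by have [_ /andP[]] := sS n.
  have [_ /andP[_ q] _] := sS n; apply: le_trans (lerD q (lexx (H n.+1))) _.
  by rewrite -addrA lerD2l !HS -splitr.
have [L dL] := (entireP h).1 eh (x +i* y).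
set p := (b - a) + (d - c).
have p0 : 0 < p by rewrite /p; lra.
(* With this tolerance the upper bound [2 * e * (p / 2 ^+ n) ^+ 2] is half of the lower bound
   [k / 4 ^+ n]. *)
have e0 : 0 < k / (4 * p ^+ 2) by rewrite divr_gt0// mulr_gt0// exprn_gt0.
have [r r0 rP] := rectint_small eh dL e0.
have [n nr] : exists n, p / 2 ^+ n < r.
  exists (Num.bound (p / r)); rewrite ltr_pdivrMr ?exprn_gt0// mulrC -ltr_pdivrMr//.
  apply: lt_le_trans (archi_boundP _) _; first by rewrite divr_ge0// ltW.
  by rewrite -natrX ler_nat ltnW// ltn_expl.
have WH : W n + H n = p / 2 ^+ n by rewrite /W /H -mulrDl.
have := rP (s n).1 ((s n).1 + W n) (s n).2 ((s n).2 + H n) (xP n) (yP n).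
rewrite !(addrAC _ _ (- _)) !subrr !add0r WH => /(_ nr).
move: (sP n); rewrite /P => + h2 => /le_trans/(_ h2).
have -> : 2 * (k / (4 * p ^+ 2)) * (p / 2 ^+ n) ^+ 2 = k / 4 ^+ n / 2.
  have -> : 4 ^+ n = (2 ^+ n) ^+ 2 :> R by rewrite -!natrX -!expnM mulnC expnM.
  by field; rewrite expf_neq0//= gt_eqF.
have : 0 < k / 4 ^+ n by rewrite divr_gt0// exprn_gt0.
by lra.
Qed.

(* Goursat for [g \o cexp] on [s, 0] x [0, 2 pi]: the vertical sides are the
   circles of radii exp(s) and 1, and the horizontal sides cancel. *)
Lemma circle_mean_Im (g : R[i] -> R[i]) : entire g ->
  segint 0 (2 * pi) (fun t => Im (g (cexp (0 +i* t)))) = Im (g 0) * (2 * pi).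
Proof.
move=> eg; have pi2 : 0 < 2 * pi :> R by rewrite mulr_gt0// pi_gt0.
have eh : entire (fun z => g (cexp z)) by exact: entire_comp eg (@entire_cexp R).
apply/eqP; rewrite -subr_eq0 -normr_le0; apply/ler_addgt0Pl => e e0; rewrite addr0.
have e0' : 0 < e / (2 * pi) by rewrite divr_gt0.
have [d d0 dP] := entire_near 0 eg e0'.
(* Chosen so that [expR (- s)] exceeds [d^-1]: the circle of radius [expR s] lies where [g] is close
   to [g 0]. *)
pose s : R := - (1 + d^-1).
have s0 : s < 0 by rewrite oppr_lt0 addr_gt0// invr_gt0.
have sd : expR s < d.
  have := expR_gt1Dx (lt0r_neq0 (ltr_wpDl ler01 (_ : 0 < d^-1)));
    rewrite invr_gt0 => /(_ d0) h.
  rewrite expRN -[ltRHS]invrK ltf_pV2 ?posrE ?expR_gt0 ?invr_gt0//.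
  by apply: lt_trans h; lra.
have := goursat eh s0 pi2; rewrite /rectint.
have -> : (fun x => Re (g (cexp (x +i* (2 * pi))))) =
  (fun x => Re (g (cexp (x +i* 0)))).
  apply/funext => x; congr (Re (g _)); rewrite /cexp.
  by rewrite (_ : 2 * pi = 0 + pi *+ 2) ?cosD2pi ?sinD2pi// add0r mulr_natl.
rewrite subrr sub0r => /eqP; rewrite addrC subr_eq0 => /eqP <-.
have cv := (continuous_curve eh (fun x y => normc_vertical x y s)).2.
have := @segint_near _ _ 0 (2 * pi) (Im (g 0)) (e / (2 * pi)) cv (ltW pi2).
rewrite subr0 divfK ?gt_eqF//; apply => t _.
have : normc (cexp (s +i* t) - 0) < d by rewrite subr0 normc_cexp.
move=> /dP /ltW; apply: le_trans; apply: le_trans (ler_Im_normc _).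
by case: (g (cexp _)) (g 0) => [? ?] [? ?].
Qed.

End goursat.

(** * Invariance of the area measure *)

Section area_invariance.
Variable R : realType.
Local Notation leb := (@lebesgue_measure R).
Local Notation plane := (leb \x leb)%E.
Local Open Scope ereal_scope.

(** The pushforward of Lebesgue measure under the shift agrees with it on half-open intervals, hence
    everywhere by uniqueness. *)
Lemma ge0_integral_shift (t : R) (f : R -> \bar R) :
  measurable_fun setT f -> (forall x, 0 <= f x) ->
  \int[leb]_x f (x + t)%R = \int[leb]_x f x.
Proof.
move=> mf f0.
have mt : measurable_fun setT (fun x : measurableTypeR R =>
  (x + t)%R : measurableTypeR R).
  by apply: measurable_funD => //; exact: measurable_cst.
have -> : \int[leb]_x f (x + t)%R =
  \int[pushforward leb (fun x : measurableTypeR R =>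
  (x + t)%R : measurableTypeR R)]_x f x.
  by rewrite ge0_integral_pushforward.
apply: eq_measure_integral => A mA _; apply/esym.
apply: (@lebesgue_measure_unique R
  (measure_function_pushforward__canonical__measure_function_Measure leb mt))
  => //= _ [[a b]] _ <-.
rewrite /pushforward /=.
have -> : (fun x : measurableTypeR R => (x + t)%R : measurableTypeR R) @^-1` `]a,
  b] = `](a - t)%R, (b - t)%R]%classic.
  by apply/seteqP; split => x /=; rewrite !in_itv/= ltrBlDr lerBrDr.
rewrite !lebesgue_measure_itv/= !lte_fin ltrD2r; case: ifP => // _.
by congr (_%:E); lra.
Qed.

Lemma ge0_integral_area (F : R[i] -> \bar R) :
  measurable_fun setT F -> (forall z, 0 <= F z) ->
  \int[@area R]_z F z = (pi^-1)%:E * \int[plane]_p F (complex_of_pair p).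
Proof.
move=> mF F0; rewrite /area ge0_integral_mscale//=.
by rewrite ge0_integral_pushforward//; exact: mcomplex_of_pair.
Qed.

(** Phrased through nonnegative integrands rather than sets, so that composition is a rewriting
    step; signed integrands follow by splitting into positive and negative parts. *)
Definition area_preserving (phi : R[i] -> R[i]) := forall F : R[i] -> \bar R,
  measurable_fun setT F -> (forall z, 0 <= F z) ->
  \int[@area R]_z F (phi z) = \int[@area R]_z F z.

Lemma measurable_of_ReIm d (T : measurableType d) (f : T -> R[i]) :
  measurable_fun setT (fun x => Re (f x)) -> measurable_fun setT (fun x => Im (f x)) ->
  measurable_fun setT f.
Proof.
move=> mr mi.
have -> : f = @complex_of_pair R \o (fun x => (Re (f x), Im (f x))).
  by apply/funext => x /=; case: (f x).
apply: measurableT_comp; first exact: measurable_complex_of_pair.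
exact: measurable_fun_pair.
Qed.

Lemma continuous_Re : continuous (@complex.Re R).
Proof.
apply: lip1_continuousC => z w.
by apply: le_trans (ler_Re_normc _); case: z w => [a b] [c d].
Qed.

Lemma continuous_Im : continuous (@complex.Im R).
Proof.
apply: lip1_continuousC => z w.
by apply: le_trans (ler_Im_normc _); case: z w => [a b] [c d].
Qed.

Lemma measurable_Re : measurable_fun setT (@complex.Re R).
Proof. exact: measurable_continuousC continuous_Re. Qed.

Lemma measurable_Im : measurable_fun setT (@complex.Im R).
Proof. exact: measurable_continuousC continuous_Im. Qed.

Lemma area_preserving_comp phi psi : measurable_fun setT phi ->
  area_preserving phi -> area_preserving psi -> area_preserving (fun z => phi (psi z)).
Proof.
move=> mphi Hphi Hpsi F mF F0.
by rewrite (Hpsi (fun z => F (phi z))) ?Hphi//; exact: measurableT_comp.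
Qed.

(* [g] may be a constant or linear in [Im z], so this covers both translations
   and shears. *)
Lemma area_preserving_horizontal (g : R -> R) : measurable_fun setT g ->
  area_preserving (fun z => (Re z + g (Im z)) +i* Im z)%R.
Proof.
move=> mg F mF F0.
have mphi : measurable_fun setT (fun z : R[i] => (Re z + g (Im z)) +i* Im z)%R.
  apply: measurable_of_ReIm => /=; last exact: measurable_Im.
  apply: measurable_funD; first exact: measurable_Re.
  by apply: measurableT_comp => //; exact: measurable_Im.
have mFphi := measurableT_comp mF mphi.
rewrite !ge0_integral_area//; congr (_ * _).
have mc : measurable_fun setT (@complex_of_pair R : measurableTypeR R *
  measurableTypeR R -> R[i]) := @mcomplex_of_pair R.
(* With the imaginary part [y] as outer variable, the inner integral sees only a translation by the
   constant [g y]. *)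
rewrite [LHS](fubini_tonelli2 (fun p : measurableTypeR R * measurableTypeR R =>
  F (((p.1 : R) + g p.2) +i* p.2)%R))//; last first.
  exact: (measurableT_comp mFphi mc).
rewrite [RHS](fubini_tonelli2 (fun p : measurableTypeR R * measurableTypeR R =>
  F (complex_of_pair p)))//; last first.
  exact: (measurableT_comp mF mc).
apply: eq_integral => y _; rewrite /fubini_G /=.
apply: (ge0_integral_shift (g y) (f := fun x => F (x +i* y)%R)) => //.
exact: (measurableT_comp (measurableT_comp mF mc) (measurable_pair2 y)).
Qed.

Lemma area_preserving_vertical (g : R -> R) : measurable_fun setT g ->
  area_preserving (fun z => Re z +i* (Im z + g (Re z)))%R.
Proof.
move=> mg F mF F0.
have mphi : measurable_fun setT (fun z : R[i] => Re z +i* (Im z + g (Re z)))%R.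
  apply: measurable_of_ReIm => /=; first exact: measurable_Re.
  apply: measurable_funD; first exact: measurable_Im.
  by apply: measurableT_comp => //; exact: measurable_Re.
have mFphi := measurableT_comp mF mphi.
rewrite !ge0_integral_area//; congr (_ * _).
have mc : measurable_fun setT (@complex_of_pair R : measurableTypeR R *
  measurableTypeR R -> R[i]) := @mcomplex_of_pair R.
rewrite [LHS](fubini_tonelli1 (fun p : measurableTypeR R * measurableTypeR R =>
  F (p.1 +i* ((p.2 : R) + g p.1))%R))//; last first.
  exact: (measurableT_comp mFphi mc).
rewrite [RHS](fubini_tonelli1 (fun p : measurableTypeR R * measurableTypeR R =>
  F (complex_of_pair p)))//; last first.
  exact: (measurableT_comp mF mc).
apply: eq_integral => x _; rewrite /fubini_F /=.
apply: (ge0_integral_shift (g x) (f := fun y => F (x +i* y)%R)) => //.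
exact: (measurableT_comp (measurableT_comp mF mc) (measurable_pair1 x)).
Qed.

Lemma area_preserving_translation (b : R[i]) : area_preserving (fun z => z + b)%R.
Proof.
have := area_preserving_comp _ (area_preserving_horizontal (measurable_cst (Re b)))
  (area_preserving_vertical (measurable_cst (Im b))).
have -> : (fun z : R[i] => z + b)%R =
    (fun z : R[i] => (Re z + Re b) +i* (Im z + Im b))%R.
  by apply/funext => -[x y]; case: b => c d.
apply; apply: measurable_of_ReIm => /=; last exact: measurable_Im.
by apply: measurable_funD; [exact: measurable_Re|exact: measurable_cst].
Qed.

Lemma measurable_mulC (u : R[i]) : measurable_fun setT (fun z => u * z)%R.
Proof.
case: u => a b; rewrite (_ : (fun _ => _) = fun z : R[i] =>
    (a * Re z - b * Im z) +i* (a * Im z + b * Re z))%R; last first.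
  by apply/funext => -[x y].
have mR := measurable_Re; have mI := measurable_Im.
by apply: measurable_of_ReIm => /=; [apply: measurable_funB|apply: measurable_funD];
  apply: measurable_funM.
Qed.

(* A rotation with nonzero sine [s] and cosine [c] is a product of three shears
   with slopes [(c - 1) / s], [s], [(c - 1) / s]; minus the identity is the
   square of a quarter turn. *)
Lemma area_preserving_rotation (u : R[i]) : normc u = 1%R ->
  area_preserving (fun z => u * z)%R.
Proof.
have shear (c s : R) : s != 0%R -> (c ^+ 2 + s ^+ 2 = 1)%R ->
    area_preserving (fun z => (c +i* s) * z)%R.
  move=> s0 cs; set t := ((c - 1) / s)%R.
  have mt (r : R) : measurable_fun setT (fun x : R =>
    r * x)%R by exact: measurable_funM.
  have H := area_preserving_horizontal (mt t).
  have V := area_preserving_vertical (mt s).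
  have mR := measurable_Re; have mI := measurable_Im.
  have mH : measurable_fun setT (fun z : R[i] => (Re z + t * Im z) +i* Im z)%R.
    by apply: measurable_of_ReIm => //=; apply: measurable_funD => //;
      exact: measurable_funM.
  have mV : measurable_fun setT (fun z : R[i] => Re z +i* (Im z + s * Re z))%R.
    by apply: measurable_of_ReIm => //=; apply: measurable_funD => //;
      exact: measurable_funM.
  have := area_preserving_comp mH H (area_preserving_comp mV V H).
  congr area_preserving; apply/funext => -[x y] /=.
  have s2 : (s ^+ 2 = (1 - c) * (1 + c))%R by have ->
    : ((1 - c) * (1 + c) = 1 - c ^+ 2)%R by [ring]; rewrite -cs; ring.
  have ts : (t * s = c - 1)%R by rewrite /t divfK.
  have tc : (t * (1 + c) = - s)%R.
    by apply: (mulIf s0); rewrite mulrAC ts mulNr -expr2 s2; ring.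
  have E1 : (x + t * y + t * (y + s * (x + t * y)) = c * x - s * y)%R.
    have -> : (x + t * y + t * (y + s * (x + t * y)) =
      x * (1 + t * s) + y * (t * (1 + (1 + t * s))))%R by ring.
    by rewrite ts (addrC 1%R (c - 1)%R) subrK tc; ring.
  have E2 : (y + s * (x + t * y) = c * y + s * x)%R.
    have -> : (y + s * (x + t * y) = y * (1 + t * s) + s * x)%R by ring.
    by rewrite ts; ring.
  by rewrite E1 E2.
case: u => c s nu.
have cs : (c ^+ 2 + s ^+ 2 = 1)%R by rewrite -[LHS](normc_sqr (c +i* s)) nu expr1n.
have [s0|s0] := eqVneq s 0%R; last exact: shear.
move: cs; rewrite s0 expr0n addr0 => /eqP; rewrite sqrf_eq1 => /orP[|] /eqP ->.
  by move=> F mF F0; apply: eq_integral => z _;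
    rewrite [(1 +i* 0)%R]/(1%R : R[i]) mul1r.
have i2 : (0 ^+ 2 + 1 ^+ 2 = 1 :> R)%R by rewrite expr0n add0r expr1n.
have := area_preserving_comp (measurable_mulC (0 +i* 1)%R)
  (shear 0%R 1%R (oner_neq0 _) i2)
  (shear 0%R 1%R (oner_neq0 _) i2).
congr area_preserving; apply/funext => z; rewrite mulrA; congr (_ * _)%R.
by apply/eqP; rewrite eq_complex /=; apply/andP; split; apply/eqP; ring.
Qed.

Lemma area_preservingP (phi : R[i] -> R[i]) (F : R[i] -> \bar R) :
  area_preserving phi -> measurable_fun setT F ->
  \int[@area R]_z F (phi z) = \int[@area R]_z F z.
Proof.
move=> Hphi mF; rewrite integralE [RHS]integralE; congr (_ - _).
  rewrite -(Hphi F^\+)//; last exact: measurable_funepos.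
  by apply: eq_integral => z _; rewrite funepos_comp.
rewrite -(Hphi F^\-)//; last exact: measurable_funeneg.
by apply: eq_integral => z _; rewrite funeneg_comp.
Qed.

End area_invariance.

(** * Gaussian integrals and sigma-finiteness of the area measure *)

Section gaussian_measure.
Variable R : realType.
Local Notation leb := (@lebesgue_measure R).

(** Factoring the Gaussian into two normal densities derives its total mass from their
    normalisation. *)
Lemma expR_normc_sqr (s : R) (z : R[i]) : s != 0 ->
  expR (- (normc z ^+ 2) / (s ^+ 2 *+ 2)) =
  2 * s ^+ 2 * pi * (normal_pdf 0 s (Re z) * normal_pdf 0 s (Im z)).
Proof.
move=> s0; rewrite (normal_pdfE _ s0) normc_sqr /normal_fun !subr0.
rewrite [_ ^+ 2 + _]addrC opprD mulrDl expRD.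
have p0 : 0 < s ^+ 2 * pi *+ 2 by rewrite mulrn_wgt0// mulr_gt0 ?pi_gt0//
  exprn_even_gt0.
have pk : 2 * s ^+ 2 * pi * (normal_peak s * normal_peak s) = 1.
  rewrite /normal_peak; move: (@pi R) (pi_gt0 R) p0 => p pp p0.
  rewrite -invfM -expr2 sqr_sqrtr ?ltW// -mulr_natl.
  by field; rewrite s0 (gt_eqF pp).
by rewrite [_ * expR _ * _]mulrACA [_ * (normal_peak s * _ * _)]mulrA pk mul1r mulrC.
Qed.

Lemma integral_area_gaussian (s : R) : s != 0 ->
  (\int[@area R]_z (expR (- (normc z ^+ 2) / (s ^+ 2 *+ 2)))%:E = (2 * s ^+ 2)%:E)%E.
Proof.
move=> s0; under eq_integral do rewrite expR_normc_sqr//.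
have n0 := normal_pdf_ge0 0 s.
have mn := measurable_normal_pdf 0 s.
have mR := @measurable_Re R; have mI := @measurable_Im R.
have mF : measurable_fun setT (fun z : R[i] =>
  (2 * s ^+ 2 * pi * (normal_pdf 0 s (Re z) * normal_pdf 0 s (Im z)))%:E).
  apply/measurable_EFinP; apply: measurable_funM => //.
  by apply: measurable_funM; apply: measurableT_comp.
have c0 : 0 <= 2 * s ^+ 2 * pi by exact: mulr_ge0 (mulr_ge0 (ler0n _ 2)
  (sqr_ge0 s)) (pi_ge0 R).
rewrite ge0_integral_area//; last by move=> z; rewrite lee_fin;
  exact: mulr_ge0 c0 (mulr_ge0 (n0 _) (n0 _)).
have mc : measurable_fun setT (@complex_of_pair R : measurableTypeR R *
  measurableTypeR R -> R[i]) := @mcomplex_of_pair R.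
have in1 := integral_normal_pdf 0 s.
rewrite (fubini_tonelli1 (fun p : measurableTypeR R * measurableTypeR R =>
  (2 * s ^+ 2 * pi * (normal_pdf 0 s p.1 * normal_pdf 0 s p.2))%:E))//; last 2 first.
- exact: (measurableT_comp mF mc).
- by move=> p; rewrite lee_fin; exact: mulr_ge0 c0 (mulr_ge0 (n0 _) (n0 _)).
rewrite /fubini_F/=.
under eq_integral => x _.
  under eq_integral do rewrite mulrA EFinM.
  rewrite ge0_integralZl//; last 3 first.
  - exact/measurable_EFinP.
  - by move=> y _; rewrite lee_fin.
  - by rewrite lee_fin mulr_ge0.
  rewrite in1 mule1 EFinM.
  over.
rewrite /= ge0_integralZl//; last 2 first.
- exact/measurable_EFinP.
- by move=> y _; rewrite lee_fin.
by rewrite in1 mule1 -EFinM mulrC mulfK// gt_eqF// pi_gt0.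
Qed.

Lemma integral_fock_weight : (\int[@area R]_w (fock_weight w)%:E = 1)%E.
Proof.
have := @integral_area_gaussian 1 (oner_neq0 _); rewrite expr1n mulr1 => H.
rewrite /fock_weight /gauss.
under eq_integral do rewrite mulrC EFinM.
rewrite ge0_integralZl//; last by apply/measurable_EFinP; exact: measurable_gauss.
by rewrite H -EFinM mulVf.
Qed.

Lemma measurable_fock_weight : measurable_fun setT (@fock_weight R).
Proof. by apply: measurable_funM => //; exact: measurable_gauss. Qed.

(** The superlevel sets of [fock_weight] cover the plane and have finite area by Markov's
    inequality, as the weight has integral 1. Fubini in the Gaussian mean value relies on this. *)
Fact area_sigma_finite : sigma_finite setT (@area R).
Proof.
pose F n := [set w : R[i] | n.+1%:R^-1 <= fock_weight w].
exists F.
  apply/seteqP; split => // w _.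
  have w0 : 0 < fock_weight w by rewrite divr_gt0// expR_gt0.
  have [n _ /(_ n (leqnn n)) /= h] := @near_infty_natSinv_lt R (PosNum w0).
  by exists n => //; exact: ltW.
move=> n; have mFn : measurable (F n).
  rewrite -[F n]setTI; have := measurable_fock_weight measurableT.
  move=> /(_ `[n.+1%:R^-1, +oo[%classic) /(_ (measurable_itv _)).
  by congr measurable; apply/seteqP; split => w /=; rewrite in_itv/= andbT.
split => //.
have : ((n.+1%:R^-1)%:E * area (F n) <= 1)%E.
  rewrite -integral_fock_weight.
  apply: (@le_trans _ _ (\int[@area R]_(w in F n) (n.+1%:R^-1)%:E)%E).
    by rewrite integral_cst.
  apply: (@le_trans _ _ (\int[@area R]_(w in F n) (fock_weight w)%:E)%E).
    apply: ge0_le_integral => //.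
    by apply/measurable_EFinP; apply: measurable_funTS; exact: measurable_fock_weight.
  apply: ge0_subset_integral => //.
    by apply/measurable_EFinP; exact: measurable_fock_weight.
  by move=> w _; rewrite lee_fin fock_weight_ge0.
case: (area (F n)) => [r _||]; [by rewrite ltry| |by []].
by rewrite gt0_muley ?lte_fin ?invr_gt0.
Qed.

HB.instance Definition _ := @Measure_isSigmaFinite.Build _ _ _ (@area R)
  area_sigma_finite.

End gaussian_measure.

(** * Gaussian mean value *)

Section gaussian_mean.
Variable R : realType.
Local Notation leb := (@lebesgue_measure R).

Lemma fock_weightM (u w : R[i]) : normc u = 1 -> fock_weight (u * w) = fock_weight w.
Proof. by move=> u1; rewrite /fock_weight /gauss normcM u1 mul1r. Qed.

Lemma integral_indicM d (T : measurableType d) (mu : {measure set T -> \bar R})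
    (D : set T) (h : T -> R) :
  (\int[mu]_x (\1_D x * h x)%:E = \int[mu]_(x in D) (h x)%:E)%E.
Proof.
rewrite [RHS]integral_mkcond; apply: eq_integral => x _.
by rewrite patchE indicE; case: ifPn => _; rewrite ?mul1r ?mul0r.
Qed.

Lemma integral_segint (a b : R) (f : R -> R) : continuous f ->
  (\int[leb]_(x in `[a, b]) (f x)%:E = (segint a b f)%:E)%E.
Proof.
move=> cf; rewrite /segint /Rintegral fineK//.
by apply: integrable_fin_num => //; exact: continuous_segint.
Qed.

Lemma measurable_entire (f : R[i] -> R[i]) : entire f -> measurable_fun setT f.
Proof.
move=> ef; have cf : continuous f by exact: entire_continuous.
apply: measurable_of_ReIm; apply: measurable_continuousC => z;
  apply: (continuous_comp (cf z)).
  exact: continuous_Re.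
exact: continuous_Im.
Qed.

Lemma measurable_normc : measurable_fun setT (@normc R).
Proof. exact: measurable_continuousC (@continuous_normc R). Qed.

Lemma gaussian_mean_Im (g : R[i] -> R[i]) : entire g ->
  (@area R).-integrable setT (fun w => (Im (g w) * fock_weight w)%:E) ->
  (\int[@area R]_w (Im (g w) * fock_weight w)%:E = (Im (g 0))%:E)%E.
Proof.
move=> eg ig.
have pi2 : 0 < 2 * pi :> R by rewrite mulr_gt0// pi_gt0.
set D : set R := `[0, 2 * pi]%classic; have mD : measurable D by exact: measurable_itv.
have lD : leb D = (2 * pi)%:E.
  by rewrite /D lebesgue_measure_itv/= lte_fin pi2 -EFinB subr0.
pose u (t : R) : R[i] := cexp (0 +i* t).
have u1 t : normc (u t) = 1 by rewrite normc_cexp expR0.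
pose k w := (Im (g w) * fock_weight w).
have mk : measurable_fun setT k by apply/measurable_EFinP; exact: measurable_int ig.
(* The double integral of [f] is computed in two orders: over [w] first, rotation invariance gives
   [2 * pi] times the wanted integral; over [t] first, the circle mean gives [2 * pi * Im (g 0)]
   times the weight. The indicator keeps full Lebesgue measure in the first variable. *)
pose f (p : R * R[i]) := (\1_D p.1 * k (u p.1 * p.2))%:E.
have mf : measurable_fun setT f.
  apply/measurable_EFinP; apply: measurable_funM.
    by apply: measurableT_comp => //; exact: measurable_indic.
  apply: (measurableT_comp mk); apply: measurable_of_ReIm.
    rewrite (_ : (fun _ => _) = fun p : R * R[i] =>
      expR 0 * cos p.1 * Re p.2 - expR 0 * sin p.1 * Im p.2).
      apply: measurable_funB; apply: measurable_funM.
      - apply: measurable_funM => //; apply: measurableT_comp => //.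
        exact: (continuous_measurable_fun (@continuous_cos R)).
      - by apply: measurableT_comp => //; exact: measurable_Re.
      - apply: measurable_funM => //; apply: measurableT_comp => //.
        exact: (continuous_measurable_fun (@continuous_sin R)).
      - by apply: measurableT_comp => //; exact: measurable_Im.
    by apply/funext => -[t [x y]].
  rewrite (_ : (fun _ => _) = fun p : R * R[i] =>
    expR 0 * cos p.1 * Im p.2 + expR 0 * sin p.1 * Re p.2).
    apply: measurable_funD; apply: measurable_funM.
    - apply: measurable_funM => //; apply: measurableT_comp => //.
      exact: (continuous_measurable_fun (@continuous_cos R)).
    - by apply: measurableT_comp => //; exact: measurable_Im.
    - apply: measurable_funM => //; apply: measurableT_comp => //.
      exact: (continuous_measurable_fun (@continuous_sin R)).
    - by apply: measurableT_comp => //; exact: measurable_Re.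
  by apply/funext => -[t [x y]].
have Hrot t := area_preserving_rotation (u1 t).
have ik t : (@area R).-integrable setT (fun w => (k (u t * w))%:E).
  apply/integrableP; split.
    by apply/measurable_EFinP; apply: measurableT_comp => //; exact: measurable_mulC.
  rewrite (area_preservingP (Hrot t) (F := fun w => `|(k w)%:E|%E)).
    by case/integrableP : ig.
  by apply: measurableT_comp => //; exact/measurable_EFinP.
set X := (\int[_]_w _)%E; have [x xE] : exists x, X = x%:E.
  exists (fine X); rewrite fineK//; exact: integrable_fin_num.
have kX t : (\int[@area R]_w (k (u t * w))%:E = x%:E)%E.
  rewrite -xE /X (area_preservingP (Hrot t) (F := fun w => (k w)%:E))//.
  exact/measurable_EFinP.
have if_ : (leb \x @area R)%E.-integrable setT f.
  apply/(@integrable12ltyP _ _ _ _ _ leb (@area R) f mf).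
  pose A := fine (\int[@area R]_w `|k w|%:E)%E.
  have mak : measurable_fun setT (fun w => `|k w|%:E).
    by apply/measurable_EFinP; apply: measurableT_comp.
  (* By rotation invariance all slices over [D] have the same L^1 norm [A]. *)
  have AE t : (\int[@area R]_w `|f (t, w)| = (\1_D t * A)%:E)%E.
    rewrite /f /=.
    under eq_integral do rewrite normrM EFinM.
    rewrite ge0_integralZl//; last first.
      apply/measurable_EFinP; apply: measurableT_comp => //;
        apply: measurableT_comp => //.
      exact: measurable_mulC.
    rewrite (area_preservingP (Hrot t) (F := fun w => `|k w|%:E))//.
    rewrite EFinM /A fineK; first by rewrite ger0_norm// indicE.
    have /integrable_abse ia := ig; exact: integrable_fin_num ia.
  under eq_integral do rewrite AE.
  rewrite integral_indicM integral_cst//.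
  by rewrite [X in (_ * X)%E]lD -EFinM ltry.
have := @Fubini _ _ _ _ _ leb (@area R) f if_.
have -> : (\int[leb]_t \int[@area R]_w f (t, w) = (x * (2 * pi))%:E)%E.
  transitivity (\int[leb]_t (\1_D t * x)%:E)%E; last first.
    by rewrite integral_indicM integral_cst// [X in (_ * X)%E]lD.
  apply: eq_integral => t _; rewrite /f /=; under eq_integral do rewrite EFinM.
  by rewrite integralZl// kX.
have inner w : (\int[leb]_t f (t, w) = (fock_weight w * (Im (g 0) * (2 * pi)))%:E)%E.
  rewrite /f /= integral_indicM.
  have egw : entire (fun z => g (z * w)).
    apply: (entire_comp eg (g := fun z => z * w)).
    exact: (@entireM _ (fun z => z) (fun=> w) (@entire_id R) (@entire_cst R w)).
  have eh : entire (fun z => g (cexp z * w)).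
    exact: (entire_comp egw (@entire_cexp R)).
  have cv := (continuous_curve eh (fun x y => normc_vertical x y 0)).2.
  have := circle_mean_Im egw; rewrite mul0r => <-.
  under eq_integral => t _ do rewrite /k fock_weightM// mulrC EFinM.
  rewrite integralZl//; last exact: continuous_segint.
  by rewrite integral_segint.
under [in RHS]eq_integral do rewrite inner mulrC EFinM.
rewrite [in RHS]integralZl//; last first.
  apply/integrableP; split; first by apply/measurable_EFinP;
    exact: measurable_fock_weight.
  under eq_integral do rewrite gee0_abs ?lee_fin ?fock_weight_ge0//.
  by rewrite integral_fock_weight ltry.
rewrite integral_fock_weight mule1 => -[] /(mulIf (lt0r_neq0 pi2)) xg.
by rewrite xE xg.
Qed.

End gaussian_mean.

(** * Complex-valued integrals *)

Lemma normc_sqr_split (R : realType) (a b : R[i]) :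
  normc b ^+ 2 <= 2 * normc a ^+ 2 + 2 * normc (a - b) ^+ 2.
Proof.
have h : normc b <= normc a + normc (a - b).
  by rewrite -{1}(subKr a b) (le_trans (normcD _ _))// normcN.
have := normc_ge0 a; have := normc_ge0 b; have := normc_ge0 (a - b).
move: h; move: (normc a) (normc b) (normc (a - b)) => x y t h t0 y0 x0.
by have := sqr_ge0 (x - t); nra.
Qed.

Section complex_integral.
Context d (T : measurableType d) (R : realType) (mu : {measure set T -> \bar R}).
Implicit Types (f g : T -> R[i]) (G : T -> R) (c : R[i]).

Definition cintegrable f := mu.-integrable setT (fun x => (Re (f x))%:E) /\
  mu.-integrable setT (fun x => (Im (f x))%:E).

Lemma measurable_ReT f : measurable_fun setT f ->
  measurable_fun setT (fun x => Re (f x)).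
Proof. by move=> mf; apply: measurableT_comp mf; exact: measurable_Re. Qed.

Lemma measurable_ImT f : measurable_fun setT f ->
  measurable_fun setT (fun x => Im (f x)).
Proof. by move=> mf; apply: measurableT_comp mf; exact: measurable_Im. Qed.

Lemma measurable_normcT f : measurable_fun setT f ->
  measurable_fun setT (fun x => normc (f x)).
Proof. by move=> mf; apply: measurableT_comp mf; exact: measurable_normc. Qed.

Lemma measurable_funMC f g : measurable_fun setT f -> measurable_fun setT g ->
  measurable_fun setT (fun x => f x * g x).
Proof.
move=> mf mg; have rf := measurable_ReT mf; have jf := measurable_ImT mf.
have rg := measurable_ReT mg; have jg := measurable_ImT mg.
apply: measurable_of_ReIm.
  rewrite (_ : (fun _ => _) = fun x => Re (f x) * Re (g x) - Im (f x) * Im (g x)).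
    by apply: measurable_funB; exact: measurable_funM.
  by apply/funext => x; case: (f x) (g x) => [? ?] [? ?].
rewrite (_ : (fun _ => _) = fun x => Re (f x) * Im (g x) + Im (f x) * Re (g x)).
  by apply: measurable_funD; exact: measurable_funM.
by apply/funext => x; case: (f x) (g x) => [? ?] [? ?].
Qed.

Lemma measurable_conjc f : measurable_fun setT f ->
  measurable_fun setT (fun x => (f x)^*).
Proof.
move=> mf; apply: measurable_of_ReIm.
  rewrite (_ : (fun _ => _) = fun x => Re (f x)); first exact: measurable_ReT.
  by apply/funext => x; case: (f x).
rewrite (_ : (fun _ => _) = fun x => - Im (f x)).
  by apply: measurableT_comp (measurable_ImT mf).
by apply/funext => x; case: (f x).
Qed.

Lemma measurable_funBC f g : measurable_fun setT f -> measurable_fun setT g ->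
  measurable_fun setT (fun x => f x - g x).
Proof.
move=> mf mg; have rf := measurable_ReT mf; have jf := measurable_ImT mf.
have rg := measurable_ReT mg; have jg := measurable_ImT mg.
apply: measurable_of_ReIm.
  rewrite (_ : (fun _ => _) = fun x => Re (f x) - Re (g x));
    first exact: measurable_funB.
  by apply/funext => x; case: (f x) (g x) => [? ?] [? ?].
rewrite (_ : (fun _ => _) = fun x => Im (f x) - Im (g x)); first exact: measurable_funB.
by apply/funext => x; case: (f x) (g x) => [? ?] [? ?].
Qed.

Lemma measurable_RtoC G : measurable_fun setT G ->
  measurable_fun setT (fun x => (G x)%:C).
Proof. by move=> mG; apply: measurable_of_ReIm => //=; exact: measurable_cst. Qed.

Lemma cintegrable_le f G : measurable_fun setT f ->
  mu.-integrable setT (fun x => (G x)%:E) -> (forall x, normc (f x) <= G x) ->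
  cintegrable f.
Proof.
move=> mf iG fG; split; apply: le_integrable iG => //.
- by apply/measurable_EFinP; exact: measurable_ReT.
- move=> x _ /=; rewrite lee_fin (le_trans (ler_Re_normc _))// (le_trans (fG x))//.
  exact: ler_norm.
- by apply/measurable_EFinP; exact: measurable_ImT.
- move=> x _ /=; rewrite lee_fin (le_trans (ler_Im_normc _))// (le_trans (fG x))//.
  exact: ler_norm.
Qed.

(** The factor 2 comes from bounding the real and imaginary parts separately; the applications only
    need some constant. *)
Lemma normc_cintegral_le f G : measurable_fun setT f ->
  mu.-integrable setT (fun x => (G x)%:E) -> (forall x, normc (f x) <= G x) ->
  normc (cintegral mu f) <= 2 * \int[mu]_x G x.
Proof.
move=> mf iG fG; have [rf jf] := cintegrable_le mf iG fG.
apply: le_trans (normc_le_ReIm _) _; rewrite /= mulr_natl mulr2n; apply: lerD.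
  apply: le_trans (le_normr_Rintegral _ rf) _ => //; apply: le_Rintegral => //.
    exact: integrable_norm.
  by move=> x _; exact: le_trans (ler_Re_normc _) _.
apply: le_trans (le_normr_Rintegral _ jf) _ => //; apply: le_Rintegral => //.
  exact: integrable_norm.
by move=> x _; exact: le_trans (ler_Im_normc _) _.
Qed.

Lemma eq_cintegral f g : (forall x, f x = g x) -> cintegral mu f = cintegral mu g.
Proof. by move=> fg; congr cintegral; apply/funext. Qed.

Lemma cintegrableD f g : cintegrable f -> cintegrable g ->
  cintegrable (fun x => f x + g x).
Proof.
move=> [rf jf] [rg jg]; split.
  rewrite (_ : (fun _ => _) = (fun x => (Re (f x))%:E) \+ (fun x => (Re (g x))%:E))%E.
    exact: integrableD.
  by apply/funext => x /=; case: (f x) (g x) => [? ?] [? ?].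
rewrite (_ : (fun _ => _) = (fun x => (Im (f x))%:E) \+ (fun x => (Im (g x))%:E))%E.
  exact: integrableD.
by apply/funext => x /=; case: (f x) (g x) => [? ?] [? ?].
Qed.

Lemma cintegralD f g : cintegrable f -> cintegrable g ->
  cintegral mu (fun x => f x + g x) = cintegral mu f + cintegral mu g.
Proof.
move=> [rf jf] [rg jg]; rewrite /cintegral.
rewrite (@eq_Rintegral _ _ _ _ _ (fun x => Re (f x) + Re (g x))
  (fun x => Re (f x + g x))); last first.
  by move=> x _; case: (f x) (g x) => [? ?] [? ?].
rewrite (@eq_Rintegral _ _ _ _ _ (fun x => Im (f x) + Im (g x))
  (fun x => Im (f x + g x))); last first.
  by move=> x _; case: (f x) (g x) => [? ?] [? ?].
by rewrite !RintegralD.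
Qed.

Lemma cintegrableZ c f : cintegrable f -> cintegrable (fun x => c * f x).
Proof.
case: c => a b [rf jf]; split.
  rewrite (_ : (fun _ => _) = (fun x => a%:E * (Re (f x))%:E - b%:E * (Im (f x))%:E))%E.
    by apply: integrableB => //; exact: integrableZl.
  by apply/funext => x; case: (f x).
rewrite (_ : (fun _ => _) = (fun x => a%:E * (Im (f x))%:E + b%:E * (Re (f x))%:E))%E.
  by apply: integrableD => //; exact: integrableZl.
by apply/funext => x; case: (f x).
Qed.

Lemma cintegralZ c f : cintegrable f ->
  cintegral mu (fun x => c * f x) = c * cintegral mu f.
Proof.
case: c => a b [rf jf]; rewrite /cintegral.
have iZ (r : R) (h : T -> R) : mu.-integrable setT (EFin \o h) ->
    mu.-integrable setT (EFin \o (fun x => r * h x)).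
  by move=> ih; rewrite (_ : _ \o _ = fun x => (r%:E * (h x)%:E)%E)//;
    exact: integrableZl.
rewrite (@eq_Rintegral _ _ _ _ _ (fun x => a * Re (f x) - b * Im (f x))
  (fun x => Re ((a +i* b) * f x))); last first.
  by move=> x _; case: (f x).
rewrite (@eq_Rintegral _ _ _ _ _ (fun x => a * Im (f x) + b * Re (f x))
  (fun x => Im ((a +i* b) * f x))); last first.
  by move=> x _; case: (f x).
rewrite RintegralB ?RintegralD//; do ?exact: iZ.
by rewrite !RintegralZl.
Qed.

Lemma cintegral_conj f : cintegrable f ->
  cintegral mu (fun x => (f x)^*) = (cintegral mu f)^*.
Proof.
move=> [rf jf]; rewrite /cintegral /=.
rewrite (@eq_Rintegral _ _ _ _ _ (fun x => Re (f x)) (fun x => Re (f x)^*)); last first.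
  by move=> x _; case: (f x).
rewrite (@eq_Rintegral _ _ _ _ _ (fun x => -1 * Im (f x)) (fun x => Im (f x)^*));
  last first.
  by move=> x _; case: (f x) => ? ? /=; rewrite mulN1r.
by rewrite RintegralZl// mulN1r.
Qed.



Section weighted_product.
Variable W : T -> R.
Hypotheses (mW : measurable_fun setT W) (W0 : forall x, 0 <= W x).

Lemma measurable_sqW f : measurable_fun setT f ->
  measurable_fun setT (fun x => (normc (f x) ^+ 2 * W x)%:E).
Proof.
move=> mf; apply/measurable_EFinP; apply: measurable_funM => //.
by apply: measurable_funX; exact: measurable_normcT.
Qed.

Lemma integrable_sqW f : measurable_fun setT f ->
  (\int[mu]_x (normc (f x) ^+ 2 * W x)%:E < +oo)%E ->
  mu.-integrable setT (fun x => (normc (f x) ^+ 2 * W x)%:E).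
Proof.
move=> mf fi; apply/integrableP; split; first exact: measurable_sqW.
by under eq_integral do rewrite gee0_abs ?lee_fin ?(mulr_ge0 (sqr_ge0 _) (W0 _))//.
Qed.

Lemma normc_prod_le z w (r : R) : 0 <= r ->
  normc (z * w^* * r%:C) <= normc z ^+ 2 * r + normc w ^+ 2 * r.
Proof.
move=> r0; rewrite !normcM normc_real (ger0_norm r0) -mulrDl ler_wpM2r//.
have -> : normc w^* = normc w by case: w => a b; rewrite /= sqrrN.
by have := sqr_ge0 (normc z - normc w); have := normc_ge0 z; have := normc_ge0 w; nra.
Qed.

Lemma cintegrable_prod f g : measurable_fun setT f -> measurable_fun setT g ->
  (\int[mu]_x (normc (f x) ^+ 2 * W x)%:E < +oo)%E ->
  (\int[mu]_x (normc (g x) ^+ 2 * W x)%:E < +oo)%E ->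
  cintegrable (fun x => f x * (g x)^* * (W x)%:C).
Proof.
move=> mf mg fi gi.
apply: (@cintegrable_le _ (fun x => normc (f x) ^+ 2 * W x + normc (g x) ^+ 2 * W x)).
- apply: measurable_funMC; last exact: measurable_RtoC.
  by apply: measurable_funMC => //; exact: measurable_conjc.
- rewrite (_ : (fun _ => _) = (fun x => (normc (f x) ^+ 2 * W x)%:E) \+
      (fun x => (normc (g x) ^+ 2 * W x)%:E))%E//.
  by apply: integrableD => //; exact: integrable_sqW.
- by move=> x; exact: normc_prod_le.
Qed.

Lemma cintegral_sqW f : cintegral mu (fun x => f x * (f x)^* * (W x)%:C) =
  (\int[mu]_x (normc (f x) ^+ 2 * W x))%:C.
Proof.
have E x : f x * (f x)^* * (W x)%:C = (normc (f x) ^+ 2 * W x)%:C.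
  rewrite normc_sqr; case: (f x) => a b.
  by apply/eqP; rewrite eq_complex /=; apply/andP; split; apply/eqP; ring.
by rewrite (eq_cintegral E) /cintegral /= Rintegral_cst// mul0r.
Qed.

(** A square-root-free substitute for Minkowski's inequality, meaningful for infinite integrals as
    well. It propagates both finiteness and bounds. *)
Lemma le_sqint_split f g : measurable_fun setT f -> measurable_fun setT g ->
  (\int[mu]_x (normc (g x) ^+ 2 * W x)%:E <=
   2%:E * \int[mu]_x (normc (f x) ^+ 2 * W x)%:E +
   2%:E * \int[mu]_x (normc (f x - g x) ^+ 2 * W x)%:E)%E.
Proof.
move=> mf mg; have md := measurable_funBC mf mg.
pose F (h : T -> R[i]) x := (normc (h x) ^+ 2 * W x)%:E.
have F0 h x : (0 <= F h x)%E by rewrite lee_fin; exact: mulr_ge0 (sqr_ge0 _) (W0 _).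
have F20 h x : setT x -> (0 <= 2%:E * F h x)%E.
  by move=> _; apply: mule_ge0; [rewrite lee_fin|exact: F0].
have mF h : measurable_fun setT h -> measurable_fun setT (F h) by exact: measurable_sqW.
have mF2 h : measurable_fun setT h -> measurable_fun setT (fun x => 2%:E * F h x)%E.
  by move=> mh; apply: measurable_funeM; exact: mF.
apply: (@le_trans _ _ (\int[mu]_x (2%:E * F f x + 2%:E * F (fun y =>
  f y - g y)%R x))%E).
  apply: ge0_le_integral => //.
  - by move=> x _; exact: (F0 g).
  - exact: (mF g).
  - by apply: emeasurable_funD; exact: mF2.
  - move=> x _; rewrite -!EFinM -EFinD lee_fin.
    apply: le_trans (ler_wpM2r (W0 x) (normc_sqr_split (f x) (g x))) _.
    by rewrite le_eqVlt; apply/orP; left; apply/eqP; ring.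
rewrite ge0_integralD//; [|exact: F20|exact: mF2|exact: F20|exact: mF2].
by rewrite !ge0_integralZl//; [exact: mF|exact: mF].
Qed.

End weighted_product.

End complex_integral.

Section area_transfer.
Variable R : realType.

Lemma cintegral_area_preserving (phi f : _ -> R[i]) : area_preserving phi ->
  measurable_fun setT f -> cintegral (@area R) (fun w => f (phi w)) =
    cintegral (@area R) f.
Proof.
move=> Hphi mf; rewrite /cintegral /Rintegral.
rewrite (area_preservingP Hphi (F := fun w => (Re (f w))%:E)); last first.
  by apply/measurable_EFinP; exact: measurable_ReT.
rewrite (area_preservingP Hphi (F := fun w => (Im (f w))%:E))//.
by apply/measurable_EFinP; exact: measurable_ImT.
Qed.

Lemma integrable_area_preserving (phi : R[i] -> R[i]) (F : R[i] -> \bar R) :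
  measurable_fun setT phi -> area_preserving phi ->
  (@area R).-integrable setT F -> (@area R).-integrable setT (fun w => F (phi w)).
Proof.
move=> mphi Hphi /integrableP[mF iF]; apply/integrableP; split;
  first exact: measurableT_comp.
by rewrite (area_preservingP Hphi (F := fun w => `|F w|%E))//; exact: measurableT_comp.
Qed.

(** The real part of [g] is the imaginary part of the entire function i g. *)
Lemma gaussian_mean (g : R[i] -> R[i]) : entire g ->
  cintegrable (@area R) (fun w => g w * (fock_weight w)%:C) ->
  cintegral (@area R) (fun w => g w * (fock_weight w)%:C) = g 0.
Proof.
have ReM z (r : R) : Re (z * r%:C) = Re z * r by case: z => a b /=; rewrite mulr0 subr0.
have ImM z (r : R) : Im (z * r%:C) = Im z * r by case: z => a b /=; rewrite mulr0 add0r.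
have Imi z : Im ((0 +i* 1) * z : R[i]) = Re z by case: z => a b /=;
  rewrite mul0r mul1r add0r.
move=> eg [rg jg].
have eig : entire (fun z => (0 +i* 1) * g z).
  exact: (@entireM _ (fun=> 0 +i* 1) g (@entire_cst R (0 +i* 1)) eg).
rewrite /cintegral /Rintegral.
under eq_integral do rewrite ReM.
under [in X in _ +i* X]eq_integral do rewrite ImM.
rewrite gaussian_mean_Im//=; last first.
  by move: jg; congr (_.-integrable _ _); apply/funext => w; rewrite ImM.
have := gaussian_mean_Im eig; rewrite Imi.
under eq_integral do rewrite Imi.
move=> -> //=; first by case: (g 0).
by move: rg; congr (_.-integrable _ _); apply/funext => w; rewrite ReM Imi.
Qed.

End area_transfer.

(** * The Fock space and its reproducing kernel *)

Section kernel.
Variable R : realType.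
Implicit Types (b w z : R[i]).

Lemma sqr_normcC z : (normc z ^+ 2)%:C = z * z^*.
Proof.
rewrite normc_sqr; case: z => x y /=.
by apply/eqP; rewrite eq_complex /=; apply/andP; split; apply/eqP; ring.
Qed.

Lemma gaussC w : (gauss w)%:C = cexp (- (w * w^*) / 2).
Proof.
rewrite -sqr_normcC /gauss.
have -> : - (normc w ^+ 2)%:C / 2 = (- (normc w ^+ 2) / 2)%:C :> R[i].
  by rewrite [RHS]rmorphM /= rmorphN fmorphV rmorph_nat.
by rewrite /cexp /= cos0 sin0 mulr1 mulr0.
Qed.

Lemma fock_weightC w : (fock_weight w)%:C = cexp (- (w * w^*) / 2) / 2.
Proof. by rewrite -gaussC /fock_weight [LHS]rmorphM /= fmorphV rmorph_nat. Qed.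

Lemma conj_half z : (z / 2)^* = z^* / 2.
Proof. by rewrite [LHS]rmorphM fmorphV rmorph_nat. Qed.

Lemma conj_fock_kernel b w : (fock_kernel b w)^* = cexp (b * w^* / 2).
Proof. by rewrite conj_cexp conj_half rmorphM /= conjCK. Qed.

(** In the exponent the terms b conj(w) and b conj(b) cancel, so the factor left in front of the
    weight is holomorphic in [w]. *)
Lemma kernel_translation b w :
  (fock_kernel b (w + b))^* * (fock_weight (w + b))%:C =
  cexp (- b^* / 2 * w) * (fock_weight w)%:C.
Proof.
rewrite conj_fock_kernel !fock_weightC !mulrA -!cexpD !rmorphD /=.
by congr (cexp _ / 2); field.
Qed.

Lemma entire_fock_kernel b : entire (fock_kernel b).
Proof.
have -> : fock_kernel b = fun w => cexp (b^* / 2 * w + 0).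
  by apply/funext => w; rewrite addr0 /fock_kernel mulrAC.
exact: (entire_comp (@entire_cexp R) (@entire_affine R (b^* / 2) 0)).
Qed.

Lemma sqint_fock_kernel b :
  (\int[@area R]_w (normc (fock_kernel b w) ^+ 2 * fock_weight w)%:E < +oo)%E.
Proof.
have mK := measurable_entire (@entire_fock_kernel b).
rewrite -(area_preservingP (area_preserving_translation b)); last first.
  by apply: measurable_sqW mK; exact: measurable_fock_weight.
pose c := normc (fock_kernel b b).
(* The squared modulus contains the kernel once more; this copy cancels the factor of
   [kernel_translation] up to the constant [fock_kernel b b]. *)
have key w : normc (fock_kernel b (w + b)) ^+ 2 * fock_weight (w + b) =
  c * fock_weight w.
  apply: (@complexI R); rewrite [LHS]rmorphM [RHS]rmorphM /= sqr_normcC -mulrA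
    kernel_translation mulrA.
  congr (_ * _); rewrite /fock_kernel /c -cexpD.
  have -> : b^* * (w + b) / 2 + - b^* / 2 * w = b^* * b / 2 by field.
  rewrite normc_cexp ![b^* * b]mulrC -sqr_normcC.
  have -> : (normc b ^+ 2)%:C / 2 = (normc b ^+ 2 / 2)%:C :> R[i].
    by rewrite [RHS]rmorphM /= fmorphV rmorph_nat.
  by rewrite /cexp /= cos0 sin0 mulr1 mulr0.
under eq_integral do rewrite key EFinM.
rewrite ge0_integralZl//.
- by rewrite integral_fock_weight mule1 ltry.
- by apply/measurable_EFinP; exact: measurable_fock_weight.
- by move=> w _; rewrite lee_fin fock_weight_ge0.
- by rewrite lee_fin normc_ge0.
Qed.

Lemma fock_kernel_in_fock b : fock_kernel b \in @in_fock R.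
Proof. by apply/asboolP; split;
  [exact: entire_fock_kernel|exact: sqint_fock_kernel]. Qed.

Definition kernel_fock b : fock R := Fock (fock_kernel_in_fock b).

End kernel.

Section fock_space.
Variable R : realType.
Implicit Types (f g h : fock R) (a : R[i]).

Lemma fock_entire f : entire f.
Proof. by case: f => f /= /asboolP[]. Qed.

Lemma fock_sqint f :
  (\int[@area R]_w (normc (f w) ^+ 2 * fock_weight w)%:E < +oo)%E.
Proof. by case: f => f /= /asboolP[]. Qed.

Lemma measurable_fock f : measurable_fun setT f.
Proof. exact: measurable_entire (@fock_entire f). Qed.

Lemma fockE a f g w : (a *: f + g) w = a * f w + g w.
Proof. by []. Qed.

Lemma fock0E w : (0 : fock R) w = 0.
Proof. by []. Qed.

Lemma fockBE f g w : (f - g) w = f w - g w.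
Proof. by []. Qed.

Lemma fock_ext f g : (forall w, f w = g w) -> f = g.
Proof. by move=> fg; apply: val_inj; apply/funext. Qed.

Lemma cintegrable_fock_inner f g :
  cintegrable (@area R) (fun w => f w * (g w)^* * (fock_weight w)%:C).
Proof.
apply: cintegrable_prod; rewrite ?fock_sqint//; first exact: measurable_fock_weight.
- exact: fock_weight_ge0.
- exact: measurable_fock.
- exact: measurable_fock.
Qed.

Lemma fock_inner_linear a f g h :
  fock_inner (a *: f + g) h = a * fock_inner f h + fock_inner g h.
Proof.
rewrite /fock_inner -cintegralZ; last exact: cintegrable_fock_inner.
rewrite -cintegralD; [|exact/cintegrableZ/cintegrable_fock_inner|exact:
  cintegrable_fock_inner].
by apply: eq_cintegral => w; rewrite fockE; ring.
Qed.

Lemma fock_inner_conj f g : fock_inner g f = (fock_inner f g)^*.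
Proof.
rewrite /fock_inner -cintegral_conj; last exact: cintegrable_fock_inner.
apply: eq_cintegral => w.
have Wr : ((fock_weight w)%:C)^* = (fock_weight w)%:C :> R[i].
  by rewrite -[RHS]conjCK; congr (_^*); rewrite /Num.conj /= oppr0.
by rewrite [RHS]rmorphM [X in _ = X * _]rmorphM /= Wr conjCK [in RHS](mulrC (f w)^*).
Qed.

Lemma fock_innerE f : fock_inner f f =
  (\int[@area R]_w (normc (f w) ^+ 2 * fock_weight w))%:C.
Proof. exact: cintegral_sqW. Qed.

Lemma fock_inner_ge0 f : 0 <= fock_inner f f.
Proof.
rewrite fock_innerE lecR; apply: Rintegral_ge0 => w _.
exact: mulr_ge0 (sqr_ge0 _) (fock_weight_ge0 _).
Qed.

Lemma fock_norm_sqr f : fock_norm f ^+ 2 = Re (fock_inner f f).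
Proof. by rewrite sqr_sqrtr//; have := fock_inner_ge0 f; rewrite lecE => /andP[]. Qed.

Lemma fock_norm_integral f :
  (\int[@area R]_w (normc (f w) ^+ 2 * fock_weight w)%:E = (fock_norm f ^+ 2)%:E)%E.
Proof.
rewrite fock_norm_sqr fock_innerE /= /Rintegral fineK//;
  apply: integrable_fin_num => //.
apply: integrable_sqW; first exact: measurable_fock_weight.
- exact: fock_weight_ge0.
- exact: measurable_fock.
- exact: fock_sqint.
Qed.

(* Translating by [b] turns the kernel into the factor e^{- conj(b) w / 2}, so
   the formula reduces to the Gaussian mean value of an entire function. *)
Lemma fock_reproducing f b : fock_inner f (kernel_fock b) = f b.
Proof.
have iF := cintegrable_fock_inner f (kernel_fock b).
pose F w := f w * (kernel_fock b w)^* * (fock_weight w)%:C.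
have mF : measurable_fun setT F.
  apply: measurable_funMC; last by apply: measurable_RtoC;
    exact: measurable_fock_weight.
  apply: measurable_funMC; first exact: measurable_fock.
  by apply: measurable_conjc; exact: measurable_fock.
have Hb := area_preserving_translation b.
have mb : measurable_fun setT (fun z : R[i] => z + b).
  apply: measurable_entire; have := @entire_affine R 1 b.
  by congr entire; apply/funext => z; rewrite mul1r.
pose g w := f (w + b) * cexp (- b^* / 2 * w).
have FE w : F (w + b) = g w * (fock_weight w)%:C.
  transitivity (f (w + b) * (cexp (- b^* / 2 * w) * (fock_weight w)%:C));
    last by rewrite mulrA.
  by rewrite /F -[LHS]mulrA; congr (_ * _); exact: kernel_translation.
have eg : entire g.
  have ef1 : entire (fun w => f (w + b)).
    have := entire_comp (@fock_entire f) (@entire_affine R 1 b).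
    by congr entire; apply/funext => z; rewrite mul1r.
  have ec : entire (fun w => cexp (- b^* / 2 * w)).
    have := entire_comp (@entire_cexp R) (@entire_affine R (- b^* / 2) 0).
    by congr entire; apply/funext => z; rewrite addr0.
  exact: (@entireM _ (fun w => f (w + b)) (fun w => cexp (- b^* / 2 * w)) ef1 ec).
rewrite /fock_inner -(cintegral_area_preserving Hb mF).
under eq_fun do rewrite FE.
rewrite gaussian_mean//; first by rewrite /g add0r mulr0 cexp0 mulr1.
by case: iF => rF jF; split;
  [have := integrable_area_preserving mb Hb rF|have :=
    integrable_area_preserving mb Hb jF];
  congr (_.-integrable _ _); apply/funext => w; rewrite -FE.
Qed.

End fock_space.

(** * Positive forms and Hilbert spaces *)

Section positive_form.
Variables (R : realType) (V : lmodType R[i]) (B : V -> V -> R[i]).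
Hypothesis Bl : forall a f g h, B (a *: f + g) h = a * B f h + B g h.
Hypothesis Br : forall a f g h, B h (a *: f + g) = a^* * B h f + B h g.
Hypothesis B0 : forall f, 0 <= B f f.

Lemma form_expand a f g :
  B (a *: g + f) (a *: g + f) =
  a * a^* * B g g + a * B g f + a^* * B f g + B f f.
Proof. by rewrite Bl !Br; ring. Qed.

Lemma Re_form_ge0 f : 0 <= Re (B f f).
Proof. by have := B0 f; rewrite lecE => /andP[]. Qed.

Lemma Im_form0 f : Im (B f f) = 0.
Proof. by have := B0 f; rewrite lecE => /andP[/eqP]. Qed.

(** Polarization: the diagonal values at g + f and i g + f are real. For the form of a positive
    operator this is self-adjointness. *)
Lemma form_hermitian f g : B g f = (B f g)^*.
Proof.
have E a := form_expand a f g.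
have H1 := Im_form0 (1 *: g + f); have H2 := Im_form0 ((0 +i* 1) *: g + f).
rewrite E in H1; rewrite E in H2; move: H1 H2 (Im_form0 f) (Im_form0 g).
case: (B g f) (B f g) (B g g) (B f f) => [a b] [c d] [x y] [z t] /= H1 H2 H3 H4.
by apply/eqP; rewrite eq_complex /=; apply/andP; split; apply/eqP; lra.
Qed.

Lemma form_cauchy_schwarz f g :
  normc (B f g) ^+ 2 <= Re (B f f) * Re (B g g).
Proof.
(* The coefficient [t%:C * B f g] aligns the phases, so that a quadratic in the real variable [t]
   remains. *)
have H t : 0 <= Re (B f f) + 2 * t * normc (B f g) ^+ 2 +
    t ^+ 2 * normc (B f g) ^+ 2 * Re (B g g).
  have := Re_form_ge0 ((t%:C * B f g) *: g + f).
  rewrite form_expand (form_hermitian f g) normc_sqr.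
  have := Im_form0 g.
  case: (B f g) (B g g) (B f f) => [c d] [x y] [z s] /= -> h.
  by apply: le_trans h _; rewrite le_eqVlt; apply/orP; left; apply/eqP; ring.
have f0 := Re_form_ge0 f; have g0 := Re_form_ge0 g.
move: H f0 g0; move: (Re (B f f)) (Re (B g g)) (normc _ ^+ 2)
  (sqr_ge0 (normc (B f g))) => a c n n0 H a0 c0.
have [c_eq0|c_neq0] := eqVneq c 0.
  rewrite c_eq0 mulr0; have [->//|nn0] := eqVneq n 0.
  (* The form may be degenerate; then the quadratic is affine in [t], and this [t] gives it the
     negative value [- a - 2]. *)
  have := H (- (a + 1) / n); rewrite c_eq0 mulr0 addr0 -mulrA divfK//; lra.
have cp : 0 < c by rewrite lt_neqAle eq_sym c_neq0.
have := H (- c^-1).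
have -> : a + 2 * - c^-1 * n + (- c^-1) ^+ 2 * n * c = a - n / c by field.
by rewrite subr_ge0 ler_pdivrMr.
Qed.

End positive_form.

(** * Orthogonality, coercive and positive operators in an abstract Hilbert space *)

Section hilbert.
Variables (R : realType) (V : lmodType R[i]) (ip : V -> V -> R[i]).
Hypothesis ip_linear : forall a f g h, ip (a *: f + g) h = a * ip f h + ip g h.
Hypothesis ip_conj : forall f g, ip g f = (ip f g)^*.
Hypothesis ip_ge0 : forall f, 0 <= ip f f.
Local Notation nrm f := (Num.sqrt (Re (ip f f))).

Lemma ip_antilinear a f g h : ip h (a *: f + g) = a^* * ip h f + ip h g.
Proof. by rewrite ip_conj ip_linear rmorphD rmorphM /= -!ip_conj. Qed.

Lemma ipDl f g h : ip (f + g) h = ip f h + ip g h.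
Proof. by rewrite -[f]scale1r ip_linear scale1r mul1r. Qed.

Lemma ipDr f g h : ip h (f + g) = ip h f + ip h g.
Proof. by rewrite -[f]scale1r ip_antilinear scale1r rmorph1 mul1r. Qed.

Lemma ip0l h : ip 0 h = 0.
Proof. by have /eqP := ipDl 0 0 h; rewrite addr0 -subr_eq subrr eq_sym => /eqP. Qed.

Lemma ip0r h : ip h 0 = 0.
Proof. by rewrite ip_conj ip0l rmorph0. Qed.

Lemma ipZl a f h : ip (a *: f) h = a * ip f h.
Proof. by rewrite -[a *: f]addr0 ip_linear ip0l addr0. Qed.

Lemma ipZr a f h : ip h (a *: f) = a^* * ip h f.
Proof. by rewrite ip_conj ipZl rmorphM /= -ip_conj. Qed.

Lemma ipNl f h : ip (- f) h = - ip f h.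
Proof. by rewrite -scaleN1r ipZl mulN1r. Qed.

Lemma ipNr f h : ip h (- f) = - ip h f.
Proof. by rewrite ip_conj ipNl rmorphN /= -ip_conj. Qed.

Lemma nrm_ge0 f : 0 <= nrm f. Proof. exact: sqrtr_ge0. Qed.

Lemma sqr_nrm f : nrm f ^+ 2 = Re (ip f f).
Proof. by rewrite sqr_sqrtr// (Re_form_ge0 ip_ge0). Qed.

Lemma ip_cauchy_schwarz f g : normc (ip f g) <= nrm f * nrm g.
Proof.
rewrite -(@ler_pXn2r _ 2) ?nnegrE ?mulr_ge0 ?normc_ge0 ?nrm_ge0// exprMn !sqr_nrm.
exact: (form_cauchy_schwarz ip_linear (fun a f g h => ip_antilinear a f g h) ip_ge0).
Qed.

Lemma sqr_nrmD f g : nrm (f + g) ^+ 2 = nrm f ^+ 2 + 2 * Re (ip f g) + nrm g ^+ 2.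
Proof.
rewrite !sqr_nrm ipDl !ipDr (ip_conj f g).
by case: (ip f g) (ip f f) (ip g g) => [a b] [c d] [x y] /=; ring.
Qed.

Lemma nrmN f : nrm (- f) = nrm f.
Proof. by rewrite ipNl ipNr opprK. Qed.

Lemma nrm_subC f g : nrm (f - g) = nrm (g - f).
Proof. by rewrite -nrmN opprB. Qed.

Lemma nrmD f g : nrm (f + g) <= nrm f + nrm g.
Proof.
rewrite -(@ler_pXn2r _ 2) ?nnegrE ?addr_ge0 ?nrm_ge0// sqr_nrmD sqrrD.
rewrite lerD2r lerD2l -[leRHS]mulr_natl ler_wpM2l//.
apply: le_trans (ler_norm _) _; apply: le_trans (ler_Re_normc _) _.
exact: ip_cauchy_schwarz.
Qed.

Lemma nrm_triangle g f h : nrm (f - h) <= nrm (f - g) + nrm (g - h).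
Proof. by have := nrmD (f - g) (g - h); rewrite addrA subrK. Qed.

Lemma parallelogram f g : nrm (f + g) ^+ 2 + nrm (f - g) ^+ 2 =
  2 * (nrm f ^+ 2 + nrm g ^+ 2).
Proof.
rewrite !sqr_nrmD nrmN ipNr.
by case: (ip f g) => a b /=; ring.
Qed.

Lemma nrmZ a f : nrm (a *: f) = normc a * nrm f.
Proof.
apply: (@pexpIrn _ 2); rewrite ?nnegrE ?mulr_ge0 ?nrm_ge0 ?normc_ge0//.
rewrite exprMn !sqr_nrm ipZl ip_conj ipZl rmorphM /= -ip_conj normc_sqr mulrA.
have := Im_form0 ip_ge0 f.
by case: a (ip f f) => [a b] [c d] /= ->; ring.
Qed.

Hypothesis nrm_eq0 : forall f, nrm f = 0 -> f = 0.

(** One index suffices, because in [complete] the bound [rho n] already controls all later terms.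
    Explicit rates are inherited by the limits. *)
Definition small (rho : nat -> R) := forall e, 0 < e -> exists n, rho n < e.

Hypothesis complete : forall (u : nat -> V) (rho : nat -> R),
  (forall n m, (n <= m)%N -> nrm (u m - u n) <= rho n) -> small rho ->
  exists l, forall n, nrm (u n - l) <= rho n.

Lemma small_harmonic (c : R) : 0 <= c -> small (fun n => c / n.+1%:R).
Proof.
move=> c0 e e0; exists (Num.bound (c / e));
  rewrite ltr_pdivrMr ?ltr0n// mulrC -ltr_pdivrMr//.
apply: lt_trans (archi_boundP _) _; first by rewrite divr_ge0// ltW.
by rewrite ltr_nat.
Qed.

Lemma le_sqr_of_small (a b : R) : 0 <= b ->
  (forall e, 0 < e -> a <= (b + e) ^+ 2) -> a <= b ^+ 2.
Proof.
move=> b0 H; have [a0|a0] := leP a 0; first by rewrite (le_trans a0)// sqr_ge0.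
rewrite -[a]sqr_sqrtr ?(ltW a0)// ler_pXn2r ?nnegrE ?sqrtr_ge0//.
apply/ler_addgt0Pr => e e0.
rewrite -(@ler_pXn2r _ 2) ?nnegrE ?sqrtr_ge0 ?addr_ge0 ?(ltW e0)//.
by rewrite sqr_sqrtr ?(ltW a0)// H.
Qed.

Definition dense_set (D : set V) := forall f e, 0 < e ->
  exists2 v, D v & nrm (f - v) < e.

(* The nearest point [p] of the closure of [D] to [f] is the limit of a
   minimizing sequence, Cauchy by the parallelogram identity; then [f - p] is
   orthogonal to [D]. *)
Lemma dense_of_orthogonal (D : set V) : D 0 ->
  (forall a f g, D f -> D g -> D (a *: f + g)) ->
  (forall f, (forall v, D v -> ip f v = 0) -> f = 0) -> dense_set D.
Proof.
move=> D0 Dl Dorth f.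
pose S := [set nrm (f - v) ^+ 2 | v in D].
have S0 : S !=set0 by exists (nrm (f - 0) ^+ 2); exists 0.
have lbS : has_lbound S by exists 0 => _ [v _ <-]; exact: sqr_ge0.
have infS : has_inf S by [].
set d := inf S.
have dP v : D v -> d <= nrm (f - v) ^+ 2 by move=> Dv; apply: ge_inf => //; exists v.
(* The slack is a square so that the parallelogram identity gives the rate [2 / n.+1%:R] for the
   norms themselves. *)
have /choice[v vP] n : exists v, D v /\ nrm (f - v) ^+ 2 <= d + (n.+1%:R^-1) ^+ 2.
  have [|_ [v Dv <-] /ltW h] := @inf_adherent _ S ((n.+1%:R^-1) ^+ 2) _ infS.
    by rewrite exprn_gt0// invr_gt0.
  by exists v.
have cauchy n m : (n <= m)%N -> nrm (v m - v n) <= 2 / n.+1%:R.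
  move=> nm; have [Dn hn] := vP n; have [Dm hm] := vP m.
  have := parallelogram (f - v n) (f - v m).
  have -> : f - v n - (f - v m) = v m - v n by rewrite opprB addrC subrKA.
  have -> : f - v n + (f - v m) =
    (2%:C : R[i]) *: (f - (2%:C : R[i])^-1 *: (v n + v m)).
    rewrite scalerBr scalerA mulfV ?scale1r;
      last by rewrite -(rmorph0 (real_complex R)) (inj_eq (@complexI R)).
    by rewrite addrACA -opprD rmorph_nat scaler_nat mulr2n.
  rewrite nrmZ normc_real ger0_norm// exprMn.
  have hd : d <= nrm (f - (2%:C : R[i])^-1 *: (v n + v m)) ^+ 2.
    by apply: dP; rewrite -[_ *: _]addr0; apply: (Dl) => //; rewrite -[v n]scale1r;
      exact: (Dl).
  have mn : (m.+1%:R^-1) ^+ 2 <= (n.+1%:R^-1) ^+ 2 :> R.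
    by rewrite ler_pXn2r ?nnegrE ?invr_ge0// lef_pV2 ?posrE// ler_nat.
  move=> E; rewrite -(@ler_pXn2r _ 2) ?nnegrE ?nrm_ge0 ?divr_ge0// exprMn.
  move: hn hm hd mn E; move: (n.+1%:R^-1 ^+ 2) (m.+1%:R^-1 ^+ 2) => en em.
  move: (nrm (f - v n) ^+ 2) (nrm (f - v m) ^+ 2) (nrm (v m - v n) ^+ 2)
    (nrm (f - _) ^+ 2).
  by move=> a b c x; lra.
have [p pP] := complete cauchy (small_harmonic (ler0n _ 2)).
(* [p] is only a limit of the [v n], so the bound at [w + v n] is passed to the limit. *)
have far w : D w -> d <= nrm (f - p - w) ^+ 2.
  move=> Dw; apply: le_sqr_of_small; first exact: nrm_ge0.
  move=> e e0; have [n ne] := small_harmonic (ler0n R 2) e0.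
  have [Dn _] := vP n.
  have := dP (w + v n); rewrite -{1}[w]scale1r => /(_ (Dl _ _ _ Dw Dn)) /le_trans;
    apply.
  rewrite ler_pXn2r ?nnegrE ?addr_ge0 ?nrm_ge0 ?(ltW e0)//.
  have -> : f - (w + v n) = (f - p - w) + (p - v n).
    by rewrite [f - p - w]addrAC subrKA opprD addrA.
  apply: le_trans (nrmD _ _) _; rewrite lerD2l nrm_subC.
  by apply: le_trans (pP n) (ltW ne).
have near_p : nrm (f - p) ^+ 2 <= d.
  rewrite -[d]sqr_sqrtr; last by apply: lb_le_inf => // _ [w _ <-]; exact: sqr_ge0.
  apply: le_sqr_of_small => [|e e0]; first exact: sqrtr_ge0.
  have d0 : 0 <= d by apply: lb_le_inf => // _ [w _ <-]; exact: sqr_ge0.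
  have [n ne] := small_harmonic (ler0n R 3) e0; have [Dn hn] := vP n.
  have n0 : 0 < n.+1%:R^-1 :> R by rewrite invr_gt0.
  rewrite ler_pXn2r ?nnegrE ?addr_ge0 ?nrm_ge0 ?sqrtr_ge0 ?(ltW e0)//.
  apply: le_trans (nrm_triangle (v n) f p) _.
  have h1 : nrm (f - v n) <= Num.sqrt d + n.+1%:R^-1.
    rewrite -(@ler_pXn2r _ 2) ?nnegrE ?addr_ge0 ?nrm_ge0 ?sqrtr_ge0 ?(ltW n0)//.
    apply: le_trans hn _; rewrite sqrrD sqr_sqrtr// lerD2r lerDl mulrn_wge0//
      mulr_ge0 ?sqrtr_ge0 ?(ltW n0).
  by have := pP n; move: h1 ne; move: (nrm _) (nrm _) (n.+1%:R^-1) => a b c; lra.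
suff /nrm_eq0/eqP : nrm (f - p) = 0.
  rewrite subr_eq0 => /eqP fp e e0; have [n ne] := small_harmonic (ler0n R 2) e0.
  have [Dn _] := vP n; exists (v n) => //.
  by rewrite nrm_subC fp; exact: le_lt_trans (pP n) ne.
suff -> : f - p = 0 by rewrite ip0l sqrtr0.
apply: Dorth => w Dw; apply: eq0_normc.
have [x xE] : exists x, ip (f - p) w = x by exists (ip (f - p) w).
rewrite xE; set c := nrm w ^+ 2.
have c0 : 0 <= c by exact: sqr_ge0.
(* A step close to the optimal 1/c that also covers [w = 0]: moving [p] by [(t%:C * x) *: w] changes
   the squared distance by [- t * (1 + t) * normc x ^+ 2]. *)
pose t := (c + 1)^-1; have t0 : 0 < t by rewrite invr_gt0 ltr_wpDl.
have Da : D ((t%:C * x) *: w) by rewrite -[_ *: _]addr0; exact: (Dl).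
have := le_trans near_p (far _ Da).
rewrite (sqr_nrmD (f - p)) nrmN nrmZ normcM normc_real (gtr0_norm t0) ipNr ipZr xE.
have -> : Re (- ((t%:C * x)^* * x)) = - (t * normc x ^+ 2).
  by rewrite normc_sqr; case: x {Da xE} => a b /=; ring.
rewrite !exprMn -/c => H.
have tc : t * (c + 1) = 1 by rewrite mulVf// gt_eqF// ltr_wpDl.
have n0 := sqr_ge0 (normc x).
have : normc x ^+ 2 <= 0.
  move: H n0; move: (normc x ^+ 2) (nrm _ ^+ 2) => n N H n0.
  have E : t ^+ 2 * n * c = t * n * (1 - t).
    have -> : 1 - t = t * c by lra.
    by ring.
  have : (t * (1 + t)) * n <= 0 by lra.
  by rewrite pmulr_rle0// mulr_gt0// addr_gt0.
rewrite le_eqVlt ltNge n0 orbF sqrf_eq0 => /eqP //.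
Qed.

(* The range of [T] is dense because a vector orthogonal to it satisfies
   [<T f, f> = 0], and closed because [T] is bounded below. *)
Lemma coercive_bijective (T : V -> V) (M c : R) :
  (forall a f g, T (a *: f + g) = a *: T f + T g) ->
  (forall f, nrm (T f) <= M * nrm f) -> 0 < c ->
  (forall f, c * nrm f ^+ 2 <= Re (ip (T f) f)) ->
  (forall f, c * nrm f <= nrm (T f)) /\ forall g, exists f, T f = g.
Proof.
move=> Tl TM c0 Tc.
have T0 : T 0 = 0.
  by have := Tl (-1) 0 0; rewrite scaler0 addr0 scaleN1r addNr.
have TB f g : T (f - g) = T f - T g.
  by rewrite addrC -scaleN1r Tl scaleN1r addrC.
have low f : c * nrm f <= nrm (T f).
  have [->|f0] := eqVneq (nrm f) 0; first by rewrite mulr0 nrm_ge0.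
  have fp : 0 < nrm f by rewrite lt_neqAle eq_sym f0 nrm_ge0.
  rewrite -(ler_pM2r fp) -mulrA -expr2; apply: le_trans (Tc f) _.
  apply: le_trans (ler_norm _) _; apply: le_trans (ler_Re_normc _) _.
  exact: ip_cauchy_schwarz.
split=> // g.
have Rd : dense_set (range T).
  apply: dense_of_orthogonal; first by exists 0.
    by move=> a _ _ [f1 _ <-] [f2 _ <-]; exists (a *: f1 + f2).
  move=> f fo; apply: nrm_eq0; apply/eqP; rewrite -sqrf_eq0 -[_ == 0]andTb.
  have := Tc f; rewrite (ip_conj f (T f)) (fo (T f)); last by exists f.
  rewrite rmorph0 /= => h; rewrite eq_le sqr_ge0 andbT.
  by rewrite -(ler_pM2l c0) mulr0.
have /choice[u uP] n : exists f, nrm (g - T f) <= 1 / n.+1%:R.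
  have [|_ [f _ <-] /ltW h] := Rd g (1 / n.+1%:R); first by rewrite divr_gt0.
  by exists f.
have cauchy n m : (n <= m)%N -> nrm (u m - u n) <= (2 / c) / n.+1%:R.
  move=> nm; rewrite mulrAC ler_pdivlMr// mulrC; apply: le_trans (low _) _.
  rewrite TB; apply: le_trans (nrm_triangle g _ _) _.
  rewrite nrm_subC; have := uP n; have := uP m.
  have : 1 / m.+1%:R <= 1 / n.+1%:R :> R by rewrite !div1r lef_pV2 ?posrE// ler_nat.
  have -> : 2 / n.+1%:R = 1 / n.+1%:R + 1 / n.+1%:R :> R by rewrite -mulrDl.
  by move: (1 / m.+1%:R) (1 / n.+1%:R) => a b; lra.
have c2 : 0 <= 2 / c by rewrite divr_ge0// ltW.
have [l lP] := complete cauchy (small_harmonic c2).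
exists l; apply/eqP; rewrite -subr_eq0; apply/eqP/nrm_eq0; apply/eqP.
rewrite eq_le nrm_ge0 andbT; apply/ler_addgt0Pl => e e0; rewrite addr0.
have K0 : 0 <= `|M| * (2 / c) + 1 by rewrite addr_ge0// mulr_ge0.
have [n ne] := small_harmonic K0 e0.
apply: le_trans (nrm_triangle (T (u n)) _ _) _; apply: le_trans _ (ltW ne).
rewrite mulrDl; apply: lerD; last by rewrite nrm_subC.
rewrite -TB; apply: le_trans (TM _) _; apply: (@le_trans _ _ (`|M| * nrm (l - u n))).
  by rewrite ler_wpM2r ?nrm_ge0// ler_norm.
by rewrite -mulrA ler_wpM2l// nrm_subC.
Qed.

(** Taking g = T f in Cauchy-Schwarz gives |T f|^4 <= <T f, f> <T T f, T f>, whose last factor is at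
    most M |T f|^2. *)
Lemma positive_bound (T : V -> V) (M : R) :
  (forall a f g, T (a *: f + g) = a *: T f + T g) ->
  (forall f, nrm (T f) <= M * nrm f) -> (forall f, 0 <= ip (T f) f) ->
  forall f, nrm (T f) ^+ 2 <= M * Re (ip (T f) f).
Proof.
move=> Tl TM Tp f.
have Bl a f1 g h : ip (T (a *: f1 + g)) h = a * ip (T f1) h + ip (T g) h.
  by rewrite Tl ip_linear.
have Br a f1 g h : ip (T h) (a *: f1 + g) = a^* * ip (T h) f1 + ip (T h) g.
  exact: ip_antilinear.
have := form_cauchy_schwarz (B := fun f g => ip (T f) g) Bl Br Tp f (T f).
(* No division is possible here; the claim is then about the sign of [M], and a nonzero [f] forces
   [0 <= M]. *)
have [-> _|n0] := eqVneq (nrm (T f)) 0.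
  have [f0|f0] := eqVneq (nrm f) 0.
    by rewrite (nrm_eq0 f0) ip0r mulr0 expr0n.
  rewrite expr0n mulr_ge0 ?(Re_form_ge0 (B := fun f g => ip (T f) g) Tp f)//.
  have := le_trans (nrm_ge0 _) (TM f); rewrite pmulr_lge0//.
  by rewrite lt_neqAle eq_sym f0 nrm_ge0.
have np : 0 < nrm (T f) by rewrite lt_neqAle eq_sym n0 nrm_ge0.
move=> H; rewrite -(ler_pM2r (exprn_gt0 2 np)).
have -> : nrm (T f) ^+ 2 * nrm (T f) ^+ 2 = normc (ip (T f) (T f)) ^+ 2.
  by rewrite normc_sqr (Im_form0 ip_ge0) expr0n addr0 !(sqr_nrm (T f)) -expr2.
apply: le_trans H _; rewrite [M * _]mulrC -mulrA.
apply: ler_wpM2l; first exact: (Re_form_ge0 (B := fun f g => ip (T f) g) Tp f).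
apply: le_trans (ler_norm _) _; apply: le_trans (ler_Re_normc _) _.
apply: le_trans (ip_cauchy_schwarz _ _) _.
by rewrite expr2 mulrA ler_wpM2r ?nrm_ge0.
Qed.

Lemma form_approx (T : V -> V) (M : R) (D : set V) :
  (forall a f g, T (a *: f + g) = a *: T f + T g) ->
  (forall f, nrm (T f) <= M * nrm f) -> dense_set D ->
  forall f e, 0 < e -> exists v, [/\ D v, nrm (f - v) < e &
    normc (ip (T f) f - ip (T v) v) < e].
Proof.
move=> Tl TM dD f e e0.
(* For |f - v| < 1 the two forms differ by at most |f - v| times |M| (2 |f| + 1); the extra 1 keeps
   [K] positive. *)
pose K := `|M| * (2 * nrm f + 1) + 1.
have K0 : 0 < K by rewrite ltr_wpDl// mulr_ge0// addr_ge0// mulr_ge0// nrm_ge0.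
have r0 : 0 < Num.min (Num.min 1 e) (e / K) by rewrite !lt_min ltr01 e0 divr_gt0.
have [v Dv] := dD f _ r0; rewrite !lt_min => /andP[/andP[v1 ve] vK].
exists v; split => //.
have TB g h : T (g - h) = T g - T h.
  by rewrite addrC -scaleN1r Tl scaleN1r addrC.
have -> : ip (T f) f - ip (T v) v = ip (T (f - v)) f + ip (T v) (f - v).
  by rewrite TB !ipDl ipNl ipDr ipNr; ring.
have TM' g : nrm (T g) <= `|M| * nrm g.
  by apply: le_trans (TM g) _; rewrite ler_wpM2r ?nrm_ge0// ler_norm.
apply: le_lt_trans (normcD _ _) _.
apply: (@le_lt_trans _ _ (nrm (f - v) * (`|M| * (2 * nrm f + 1)))).
  have nv : nrm v <= nrm f + 1.
    have := nrm_triangle f v 0; rewrite !subr0 nrm_subC; move: v1; lra.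
  have h1 : normc (ip (T (f - v)) f) <= nrm (f - v) * (`|M| * nrm f).
    apply: le_trans (ip_cauchy_schwarz _ _) _; rewrite mulrA [_ * `|M|]mulrC.
    by rewrite ler_wpM2r ?nrm_ge0.
  have h2 : normc (ip (T v) (f - v)) <= nrm (f - v) * (`|M| * (nrm f + 1)).
    apply: le_trans (ip_cauchy_schwarz _ _) _; rewrite mulrC ler_wpM2l ?nrm_ge0//.
    by apply: le_trans (TM' _) _; rewrite ler_wpM2l.
  apply: le_trans (lerD h1 h2) _; rewrite -mulrDr -mulrDr.
  by rewrite le_eqVlt; apply/orP; left; apply/eqP; ring.
apply: (@le_lt_trans _ _ (nrm (f - v) * K)).
  by rewrite ler_wpM2l ?nrm_ge0// lerDl.
by rewrite -ltr_pdivlMr.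
Qed.

End hilbert.

(** * Completeness of the Fock space *)

Lemma fatou_bound d (T : measurableType d) (R : realType)
    (mu : {measure set T -> \bar R}) (F : nat -> T -> \bar R) (G : T -> \bar R)
    (N : nat) (C : \bar R) :
  (forall n, measurable_fun setT (F n)) -> (forall n x, 0 <= F n x)%E ->
  (forall x, F n x @[n --> \oo] --> G x) ->
  (forall n, (N <= n)%N -> \int[mu]_x F n x <= C)%E -> (\int[mu]_x G x <= C)%E.
Proof.
move=> mF F0 FG FC.
have := @fatou _ _ _ mu setT measurableT F mF (fun n x _ => F0 n x).
under eq_integral => x _.
  have [-> _] := cvg_limn_einf_sup (FG x).
  over.
move/le_trans; apply; rewrite limn_einf_lim.
apply: lime_le; first exact: is_cvg_einfs.
apply: nearW => n; apply: (@le_trans _ _ (\int[mu]_x F (maxn n N) x)%E).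
  by apply: ereal_inf_lbound; exists (maxn n N) => //=; exact: leq_maxl.
by apply: FC; exact: leq_maxr.
Qed.

(** The intervals of radius [r n] around [a n] meet pairwise, so the supremum of their lower ends
    lies in all of them. *)
Lemma rate_limit (R : realType) (a r : nat -> R) :
  (forall n m, (n <= m)%N -> `|a m - a n| <= r n) ->
  exists L, forall n, `|a n - L| <= r n.
Proof.
move=> H.
have bd n m : a n - r n <= a m + r m.
  have h1 := H _ _ (leq_maxl n m); have h2 := H _ _ (leq_maxr n m).
  by move: h1 h2; rewrite !ler_norml => /andP[? ?] /andP[? ?]; lra.
pose S := range (fun n => a n - r n).
exists (sup S) => n; rewrite ler_norml.
have u : a n - r n <= sup S.
  apply: ub_le_sup; last by exists n.
  by exists (a 0%N + r 0%N) => _ [m _ <-].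
have l : sup S <= a n + r n.
  apply: ge_sup; first by exists (a 0%N - r 0%N); exists 0%N.
  by move=> _ [m _ <-].
by apply/andP; split; lra.
Qed.

(** * The Bargmann projection maps square-integrable functions to entire ones *)

Section bargmann_projection.
Variable R : realType.
Implicit Types (z w h : R[i]) (phi : R[i] -> R[i]).

Definition bargmann phi z : R[i] :=
  cintegral (@area R) (fun w => phi w * (fock_kernel z w)^* * (fock_weight w)%:C).

(** Half of the Gaussian decay absorbs the exponential: 2 a p - p^2 / 2 <= 4 a^2 - p^2 / 4. The
    other half is the Gaussian with s = sqrt 2. *)
Lemma integrable_expR_normc (a : R) :
  (\int[@area R]_w (expR (a * normc w) ^+ 2 * fock_weight w)%:E < +oo)%E.
Proof.
have s0 : Num.sqrt 2 != 0 :> R by rewrite sqrtr_eq0 -ltNge.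
have key w : expR (a * normc w) ^+ 2 * fock_weight w <=
    expR (4 * a ^+ 2) * expR (- (normc w ^+ 2) / (Num.sqrt 2 ^+ 2 *+ 2)).
  rewrite sqr_sqrtr// /fock_weight /gauss expr2 -!expRD.
  rewrite mulrA -expRD; apply: (@le_trans _ _ (expR (a * normc w + a * normc w + -
    normc w ^+ 2 / 2))).
    by rewrite ler_pdivrMr// ler_peMr ?expR_ge0// ler1n.
  rewrite ler_expR -mulr_natl.
  by have := sqr_ge0 (2 * a - normc w / 2); rewrite sqrrB; lra.
apply: (@le_lt_trans _ _ (\int[@area R]_w ((expR (4 * a ^+ 2))%:E *
    (expR (- (normc w ^+ 2) / (Num.sqrt 2 ^+ 2 *+ 2)))%:E))%E).
  have me : measurable_fun setT (fun w : R[i] => expR (a * normc w)).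
    apply: measurableT_comp => //; apply: measurable_funM => //.
    exact: measurable_normc.
  apply: ge0_le_integral => //.
  - by move=> w _; rewrite lee_fin; exact: mulr_ge0 (sqr_ge0 _) (fock_weight_ge0 _).
  - apply/measurable_EFinP; apply: measurable_funM; last exact: measurable_fock_weight.
    exact: measurable_funX.
  - apply/measurable_EFinP; apply: measurable_funM => //.
    apply: measurableT_comp => //; apply: measurable_funM => //.
    apply: measurableT_comp => //; apply: measurable_funX; exact: measurable_normc.
  - by move=> w _; rewrite -EFinM lee_fin.
rewrite ge0_integralZl//.
- by rewrite integral_area_gaussian// -EFinM ltry.
- apply/measurable_EFinP; apply: measurableT_comp => //; apply: measurable_funM => //.
  by apply: measurableT_comp => //; apply: measurable_funX; exact: measurable_normc.
Qed.

Lemma normc_conj z : normc z^* = normc z.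
Proof. by case: z => a b; rewrite /= sqrrN. Qed.

Lemma normc_half z : normc (z / 2) = normc z / 2.
Proof.
rewrite normcM; congr (_ * _).
have -> : (2^-1 : R[i]) = (2^-1)%:C by rewrite fmorphV rmorph_nat.
by rewrite normc_real ger0_norm.
Qed.

Section entire_bargmann.
Variables (phi : R[i] -> R[i]) (z : R[i]).
Hypothesis mphi : measurable_fun setT phi.
Hypothesis phi2 : (\int[@area R]_w (normc (phi w) ^+ 2 * fock_weight w)%:E < +oo)%E.

(** One majorant for the kernels at [z + h] with |h| <= 1, for their derivative and for the Taylor
    remainder; the last needs the exponent |z|/2 + 5/2. [G] then dominates |phi| E by the
    arithmetic-geometric mean inequality. *)
Let E w := expR ((normc z + 3) * normc w).
Let G w := normc (phi w) ^+ 2 * fock_weight w + E w ^+ 2 * fock_weight w.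

Let integrable_G : (@area R).-integrable setT (fun w => (G w)%:E).
Proof.
have mE : measurable_fun setT E.
  apply: measurableT_comp => //; apply: measurable_funM => //.
  exact: measurable_normc.
have := integrable_expR_normc (normc z + 3).
have En w : normc (E w)%:C = E w by rewrite normc_real ger0_norm// expR_ge0.
under eq_integral do rewrite -/(E _) -En.
move=> iE; rewrite /G.
rewrite (_ : (fun _ => _) = (fun w => (normc (phi w) ^+ 2 * fock_weight w)%:E) \+
    (fun w => (normc (E w)%:C ^+ 2 * fock_weight w)%:E))%E; last first.
  by apply/funext => w; rewrite En.
apply: integrableD => //; apply: integrable_sqW => //;
  [exact: measurable_fock_weight|exact: fock_weight_ge0|
   exact: measurable_fock_weight|exact: fock_weight_ge0|exact: measurable_RtoC].
Qed.

Let dominated (k : R[i] -> R[i]) (c : R) : 0 <= c ->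
  (forall w, normc (k w) <= c * E w) ->
  forall w, normc (phi w * k w * (fock_weight w)%:C) <= c * G w.
Proof.
move=> c0 kE w; rewrite 2!normcM normc_real (ger0_norm (fock_weight_ge0 w)).
rewrite /G -mulrDl [leRHS]mulrA ler_wpM2r ?fock_weight_ge0//.
apply: (@le_trans _ _ (normc (phi w) * (c * E w)));
  first by rewrite ler_wpM2l ?normc_ge0.
rewrite mulrCA ler_wpM2l//.
have := sqr_ge0 (normc (phi w) - E w); have := normc_ge0 (phi w).
have : 0 <= E w by exact: expR_ge0.
by nra.
Qed.

Let integrable_cG c : (@area R).-integrable setT (fun w => (c * G w)%:E).
Proof. by under eq_fun do rewrite EFinM; exact: integrableZl. Qed.

Let mint k : measurable_fun setT k ->
  measurable_fun setT (fun w => phi w * k w * (fock_weight w)%:C).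
Proof.
move=> mk; apply: measurable_funMC; last by apply: measurable_RtoC;
  exact: measurable_fock_weight.
exact: measurable_funMC.
Qed.

Let cintk k c : measurable_fun setT k -> 0 <= c -> (forall w, normc (k w) <= c * E w) ->
  cintegrable (@area R) (fun w => phi w * k w * (fock_weight w)%:C).
Proof.
move=> mk c0 kE; apply: cintegrable_le (integrable_cG c) (dominated c0 kE).
exact: mint.
Qed.

Let conjK w h : (fock_kernel (z + h) w)^* = (fock_kernel z w)^* * cexp (h * w^* / 2).
Proof. by rewrite !conj_fock_kernel -cexpD; congr cexp; ring. Qed.

Let measurable_conjK h : measurable_fun setT (fun w => (fock_kernel h w)^*).
Proof. by apply: measurable_conjc; apply: measurable_entire;
  exact: entire_fock_kernel. Qed.

Let normK h w : normc (fock_kernel h w)^* <= expR (normc h * normc w / 2).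
Proof.
rewrite conj_fock_kernel (le_trans (normc_cexp_le _))// ler_expR normc_half normcM.
by rewrite normc_conj.
Qed.

Lemma cderivative_bargmann : exists L, cderivative (bargmann phi) z L.
Proof.
(* The derivative in [z] of the conjugated kernel. Its Taylor remainder is at most |h|^2 [E w], so
   integration gives the quadratic bound directly, in place of dominated convergence. *)
pose D w : R[i] := (fock_kernel z w)^* * (w^* / 2).
have mD : measurable_fun setT D.
  apply: measurable_funMC; first exact: measurable_conjK.
  apply: measurable_funMC; last exact: measurable_cst.
  by apply: measurable_conjc; exact: measurable_id.
have ew (w : R[i]) : normc w <= expR (normc w).
  by have := expR_ge1Dx (normc w); lra.
have n0 := @normc_ge0 R.
have DE w : normc (D w) <= 1 * E w.
  rewrite mul1r normcM normc_half (normc_conj w).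
  apply: (@le_trans _ _ (expR (normc z * normc w / 2) * expR (normc w))).
    apply: ler_pM; [exact: n0|by rewrite divr_ge0|exact: normK|].
    by apply: le_trans (ew w); have := n0 w; lra.
  rewrite -expRD ler_expR; have := n0 w; have := n0 z => h1 h2.
  by have := mulr_ge0 h1 h2; nra.
have KE h : normc h <= 1 -> forall w, normc (fock_kernel (z + h) w)^* <= 1 * E w.
  move=> h1 w; rewrite mul1r (le_trans (normK _ _))// ler_expR.
  have zh := normcD z h; have := n0 w; have := n0 z => p1 p2.
  have p3 : normc (z + h) * normc w <= (normc z + 1) * normc w.
    by apply: ler_wpM2r => //; lra.
  by have := mulr_ge0 p1 p2; nra.
exists (cintegral (@area R) (fun w => phi w * D w * (fock_weight w)%:C)).
apply: (@cderivative_quadratic _ _ _ _ (2 * \int[@area R]_w G w)) => h h1.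
pose k w := (fock_kernel (z + h) w)^* - (fock_kernel z w)^* - h * D w.
have -> : bargmann phi (z + h) - bargmann phi z -
    h * cintegral (@area R) (fun w => phi w * D w * (fock_weight w)%:C) =
    cintegral (@area R) (fun w => phi w * k w * (fock_weight w)%:C).
  have i1 := cintk (measurable_conjK (z + h)) ler01 (KE h h1).
  have i2 : cintegrable (@area R)
    (fun w => phi w * (fock_kernel z w)^* * (fock_weight w)%:C).
    have := @KE 0; rewrite addr0 normc0 => /(_ ler01).
    exact: cintk (measurable_conjK z) ler01.
  have i3 := cintk mD ler01 DE.
  rewrite /bargmann -cintegralZ// -mulN1r -cintegralZ// -[in LHS](mulN1r (cintegral
    _ _)) -cintegralZ//.
    rewrite -cintegralD//; last exact: cintegrableZ.
    rewrite -cintegralD//; last by do 2 apply: cintegrableZ.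
      by apply: eq_cintegral => w; rewrite /k; ring.
    by apply: cintegrableD => //; exact: cintegrableZ.
  exact: cintegrableZ.
have mk : measurable_fun setT k.
  have -> : k = fun w => (fock_kernel z w)^* * (cexp (h * w^* / 2) - 1 - h * w^* / 2).
    by apply/funext => w; rewrite /k conjK /D; ring.
  apply: measurable_funMC; first exact: measurable_conjK.
  have eh : entire (fun w : R[i] => cexp (h / 2 * w + 0) + (- 1 + - (h / 2) * w)).
    have e1 := entire_comp (@entire_cexp R) (@entire_affine R (h / 2) 0).
    have e2 := @entire_affine R (- (h / 2)) (- 1).
    have := @entireD _ (fun w => cexp (h / 2 * w + 0)) (fun w => - (h / 2)
      * w + - 1) e1 e2.
    by congr entire; apply/funext => w; rewrite [X in _ + X]addrC.
  have := measurableT_comp (measurable_entire eh)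
    (measurable_conjc (@measurable_id _ R[i] setT)).
  by congr measurable_fun; apply/funext => w /=; rewrite addr0 addrA mulNr mulrAC.
have kE w : normc (k w) <= normc h ^+ 2 * E w.
  have -> : k w = (fock_kernel z w)^* * (cexp (h * w^* / 2) - 1 - h * w^* / 2).
    by rewrite /k conjK /D; ring.
  rewrite normcM; set p := normc w.
  have p0 : 0 <= p by exact: n0.
  have T1 := cexp_taylor (h * w^* / 2).
  have hw : normc (h * w^* / 2) =
    normc h * p / 2 by rewrite normc_half normcM normc_conj.
  rewrite hw in T1.
  have T2 : normc (cexp (h * w^* / 2) - 1 - h * w^* / 2) <=
    normc h ^+ 2 * (expR p * expR p * expR (p / 2)).
    apply: le_trans T1 _.
    have -> : 4 * (normc h * p / 2) ^+ 2 = normc h ^+ 2 * (p * p) by field.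
    rewrite -mulrA ler_wpM2l ?sqr_ge0//; apply: ler_pM => //;
      rewrite ?mulr_ge0 ?expR_ge0//.
      by apply: ler_pM => //; exact: ew.
    rewrite ler_expR ler_pdivrMr// divfK// ler_piMl//.
  apply: le_trans (ler_pM (n0 _) (n0 _) (normK z w) T2) _.
  rewrite mulrCA ler_wpM2l ?sqr_ge0// -!expRD ler_expR -/p.
  have := mulr_ge0 (n0 z) p0; nra.
apply: le_trans (normc_cintegral_le (mint mk) (integrable_cG _)
  (dominated (sqr_ge0 _) kE)) _.
rewrite RintegralZl//.
by rewrite mulrCA mulrC.
Qed.

End entire_bargmann.

Lemma entire_bargmann phi : measurable_fun setT phi ->
  (\int[@area R]_w (normc (phi w) ^+ 2 * fock_weight w)%:E < +oo)%E ->
  entire (bargmann phi).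
Proof. by move=> mphi phi2; apply/entireP => z; exact: cderivative_bargmann. Qed.

End bargmann_projection.

(** * Fatou's lemma along pointwise limits of complex functions *)

Section pointwise_limit.
Variable R : realType.

Definition cconv (b : nat -> R[i]) (l : R[i]) := forall e : R, 0 < e ->
  exists N, forall m, (N <= m)%N -> normc (b m - l) < e.

Lemma cconv_cvg (b : nat -> R[i]) l (F : R[i] -> R) : cconv b l ->
  (forall z w, `|F z - F w| <= normc (z - w)) -> F (b m) @[m --> \oo] --> F l.
Proof.
move=> bl FL; apply/cvgrPdist_lt => e e0; have [N NP] := bl e e0.
near=> m; rewrite distrC; apply: le_lt_trans (FL _ _) _; apply: NP.
by near: m; exact: nbhs_infty_ge.
Unshelve. all: by end_near. Qed.

Lemma cvg_sqW (b : nat -> R[i]) (a l : R[i]) (W : R) : cconv b l ->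
  (normc (a - b m) ^+ 2 * W)%:E @[m --> \oo] --> (normc (a - l) ^+ 2 * W)%:E.
Proof.
move=> bl; apply: cvg_EFin; first by near=> m.
apply: cvgMl; have h : normc (a - b m) @[m --> \oo] --> normc (a - l).
  apply: (@cconv_cvg b l (fun z => normc (a - z)) bl) => z w.
  apply: le_trans (ler_normcB _ _) _.
  by rewrite opprB addrC subrKA normc_subC.
by under eq_fun do rewrite expr2; rewrite expr2; exact: cvgM.
Unshelve. all: by end_near. Qed.

(** Serves for two measures: [area] in the completeness proof and [mu] in [toeplitz_form_le]. *)
Lemma fatou_sqint d (T : measurableType d) (mu : {measure set T -> \bar R})
    (W : T -> R) (b : nat -> T -> R[i]) (a l : T -> R[i]) (N : nat) (C : \bar R) :
  measurable_fun setT W -> (forall x, 0 <= W x) ->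
  (forall m, measurable_fun setT (fun x => a x - b m x)) ->
  (forall x, cconv (b^~ x) (l x)) ->
  (forall m, (N <= m)%N -> \int[mu]_x (normc (a x - b m x) ^+ 2 * W x)%:E <= C)%E ->
  (\int[mu]_x (normc (a x - l x) ^+ 2 * W x)%:E <= C)%E.
Proof.
move=> mW W0 mab bl H.
apply: (@fatou_bound _ _ _ _ (fun m x => (normc (a x - b m x) ^+ 2 * W x)%:E) _ N)
  => //.
- by move=> m; exact: measurable_sqW.
- by move=> m x; rewrite lee_fin; exact: mulr_ge0 (sqr_ge0 _) (W0 _).
- by move=> x; exact: cvg_sqW.
Qed.

End pointwise_limit.

Section fock_complete.
Variable R : realType.
Implicit Types (f g : fock R) (z w : R[i]).

Lemma fock_cauchy_schwarz f g : normc (fock_inner f g) <= fock_norm f * fock_norm g.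
Proof. exact: (ip_cauchy_schwarz (@fock_inner_linear R) (@fock_inner_conj R)
  (@fock_inner_ge0 R)). Qed.

(** Point evaluations are continuous: the norm is definite, and Cauchy sequences converge
    pointwise. *)
Lemma normc_fock_le f z : normc (f z) <= fock_norm f * fock_norm (kernel_fock z).
Proof. by rewrite -fock_reproducing; exact: fock_cauchy_schwarz. Qed.

Lemma fock_norm_ge0 f : 0 <= fock_norm f. Proof. exact: sqrtr_ge0. Qed.

Lemma fock_norm_eq0 f : fock_norm f = 0 -> f = 0.
Proof.
move=> f0; apply: fock_ext => z; apply: eq0_normc; apply/eqP.
by rewrite eq_le normc_ge0 andbT; have := normc_fock_le f z; rewrite f0 mul0r.
Qed.

Lemma fock_norm_le f (r : R) : 0 <= r ->
  (\int[@area R]_w (normc (f w) ^+ 2 * fock_weight w)%:E <= (r ^+ 2)%:E)%E ->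
  fock_norm f <= r.
Proof.
by move=> r0; rewrite fock_norm_integral lee_fin ler_pXn2r ?nnegrE ?fock_norm_ge0.
Qed.

Section limit.
Variables (u : nat -> fock R) (rho : nat -> R).
Hypothesis u_cauchy : forall n m, (n <= m)%N -> fock_norm (u m - u n) <= rho n.
Hypothesis rho_small : small rho.

Lemma rate_ge0 n : 0 <= rho n.
Proof. exact: le_trans (fock_norm_ge0 _) (u_cauchy (leqnn n)). Qed.

Lemma fock_pointwise_limit : exists l : R[i] ->
  R[i], forall w, cconv (fun n => u n w) (l w).
Proof.
suff /choice[l lP] w : exists x, cconv (fun n => u n w) x by exists l.
set K := fock_norm (kernel_fock w).
have K0 : 0 <= K by exact: fock_norm_ge0.
have H n m : (n <= m)%N -> normc (u m w - u n w) <= rho n * K.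
  move=> nm; rewrite -fockBE (le_trans (normc_fock_le _ _))//.
  by rewrite ler_wpM2r// u_cauchy.
have [x xP] : exists x, forall n, `|Re (u n w) - x| <= rho n * K.
  apply: rate_limit => n m /H; apply: le_trans; apply: le_trans (ler_Re_normc _).
  by case: (u n w) (u m w) => [? ?] [? ?].
have [y yP] : exists y, forall n, `|Im (u n w) - y| <= rho n * K.
  apply: rate_limit => n m /H; apply: le_trans; apply: le_trans (ler_Im_normc _).
  by case: (u n w) (u m w) => [? ?] [? ?].
exists (x +i* y) => e e0.
have K1 : 0 < 3 * (K + 1) by rewrite mulr_gt0// ltr_wpDl.
have [N NP] := rho_small (divr_gt0 e0 K1); exists N => m Nm.
have h1 : normc (u N w - (x +i* y)) <= rho N * K + rho N * K.
  apply: le_trans (normc_le_ReIm _) _; have := xP N; have := yP N.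
  by case: (u N w) => a b /= h1 h2; exact: lerD.
rewrite -(subrKA (u N w)); apply: le_lt_trans (normcD _ _) _.
apply: le_lt_trans (lerD (H _ _ Nm) h1) _.
move: NP; rewrite ltr_pdivlMr// => NP; apply: le_lt_trans NP.
by have := rate_ge0 N; nra.
Qed.

Lemma fock_limit : exists l : fock R, forall n, fock_norm (u n - l) <= rho n.
Proof.
have [l lP] := fock_pointwise_limit.
have ml : measurable_fun setT l.
  apply: measurable_of_ReIm.
    apply: (measurable_fun_cvg (h := fun m x => Re (u m x))) => [m|x _].
      by apply: measurable_ReT; exact: measurable_fock.
    apply: (cconv_cvg (lP x)) => z w; apply: le_trans (ler_Re_normc _).
    by case: z w => [? ?] [? ?].
  apply: (measurable_fun_cvg (h := fun m x => Im (u m x))) => [m|x _].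
    by apply: measurable_ImT; exact: measurable_fock.
  apply: (cconv_cvg (lP x)) => z w; apply: le_trans (ler_Im_normc _).
  by case: z w => [? ?] [? ?].
have mW := @measurable_fock_weight R; have W0 := @fock_weight_ge0 R.
have mul n : measurable_fun setT (fun w => u n w - l w).
  by apply: measurable_funBC => //; exact: measurable_fock.
have ul n : (\int[@area R]_w (normc (u n w - l w) ^+ 2 * fock_weight w)%:E <=
  (rho n ^+ 2)%:E)%E.
  apply: (@fatou_sqint _ _ _ (@area R) _ (fun m => u m) (u n) l n _ mW W0 _ lP)
    => [m|m nm].
    by apply: measurable_funBC; exact: measurable_fock.
  under eq_integral do rewrite -fockBE.
  rewrite fock_norm_integral lee_fin ler_pXn2r ?nnegrE ?fock_norm_ge0 ?rate_ge0//.
  rewrite /fock_norm (nrm_subC (@fock_inner_linear R) (@fock_inner_conj R)).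
  exact: u_cauchy.
have l2 : (\int[@area R]_w (normc (l w) ^+ 2 * fock_weight w)%:E < +oo)%E.
  apply: le_lt_trans (le_sqint_split (@area R) mW W0 (measurable_fock (u 0%N)) ml) _.
  apply: lte_add_pinfty; apply: lte_mul_pinfty; rewrite ?lee_fin//;
    first exact: fock_sqint.
  by apply: le_lt_trans (ul 0%N) _; rewrite ltry.
(* Each [u n] reproduces itself, so [bargmann l z] differs from [u n z] by the integral of [u n - l]
   against the kernel, which is small. *)
have lE z : l z = bargmann l z.
  apply/eqP; rewrite -subr_eq0; apply/eqP/eq0_normc/eqP; rewrite eq_le normc_ge0 andbT.
  apply/ler_addgt0Pl => e e0; rewrite addr0.
  set K := fock_norm (kernel_fock z).
  have K0 : 0 <= K by exact: fock_norm_ge0.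
  (* The three errors below are at most t, t K and t (1 + K^2), and 2 + K + K^2 <= 3 (1 + K^2). *)
  have K1 : 0 < 3 * (1 + K ^+ 2) by have := sqr_ge0 K; lra.
  have [n rn] := rho_small (divr_gt0 e0 K1).
  set t := e / (3 * (1 + K ^+ 2)) in rn; have t0 : 0 < t by exact: divr_gt0.
  pose P w := (u n w - l w) * (fock_kernel z w)^* * (fock_weight w)%:C.
  have iP : cintegrable (@area R) P.
    apply: cintegrable_prod => //; last exact: sqint_fock_kernel.
      by apply: measurable_entire; exact: entire_fock_kernel.
    by apply: le_lt_trans (ul n) _; rewrite ltry.
  have E : bargmann l z = u n z - cintegral (@area R) P.
    rewrite -fock_reproducing /fock_inner -mulN1r -cintegralZ// -cintegralD;
      last 2 first.
    - exact: cintegrable_fock_inner.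
    - exact: cintegrableZ.
    by apply: eq_cintegral => w; rewrite /P /=; ring.
  pose A w := normc (u n w - l w) ^+ 2 * fock_weight w.
  pose B w := normc (fock_kernel z w) ^+ 2 * fock_weight w.
  have iA : (@area R).-integrable setT (fun w => (A w)%:E).
    by apply: integrable_sqW => //; apply: le_lt_trans (ul n) _; rewrite ltry.
  have iB : (@area R).-integrable setT (fun w => (B w)%:E).
    apply: integrable_sqW => //; last exact: sqint_fock_kernel.
    by apply: measurable_entire; exact: entire_fock_kernel.
  have Ar : \int[@area R]_w A w <= rho n ^+ 2.
    by rewrite -lee_fin /Rintegral fineK ?ul//; exact: integrable_fin_num.
  have BK : \int[@area R]_w B w = K ^+ 2.
    by rewrite /Rintegral /B (fock_norm_integral (kernel_fock z)).
  have iZ (c : R) (G : R[i] -> R) : (@area R).-integrable setT (fun w => (G w)%:E) ->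
      (@area R).-integrable setT (fun w => (c * G w)%:E).
    by move=> iG; under eq_fun do rewrite EFinM; exact: integrableZl.
  have bP : normc (cintegral (@area R) P) <= t * (1 + K ^+ 2).
    (* [u n - l] is not yet known to lie in the Fock space, so its Cauchy-Schwarz inequality is
       replaced by a b <= a^2 / (2 t) + t b^2 / 2; the integral of [A] is at most [rho n ^+ 2],
       hence below t^2. *)
    apply: (@le_trans _ _ (2 * \int[@area R]_w (t^-1 / 2 * A w + t / 2 * B w))).
      apply: normc_cintegral_le.
      - apply: measurable_funMC; last exact: measurable_RtoC.
        apply: measurable_funMC => //; apply: measurable_conjc.
        by apply: measurable_entire; exact: entire_fock_kernel.
      - under eq_fun do rewrite EFinD; apply: integrableD => //; exact: iZ.
      - move=> w; rewrite /P /A /B 2!normcM normc_conj normc_real (ger0_norm (W0 w)).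
        have -> : t^-1 / 2 * (normc (u n w - l w) ^+ 2 * fock_weight w) +
          t / 2 * (normc (fock_kernel z w) ^+ 2 * fock_weight w) =
          (t^-1 / 2 * normc (u n w - l w) ^+ 2 + t / 2 * normc (fock_kernel z w)
            ^+ 2) * fock_weight w by ring.
        rewrite ler_wpM2r//; move: (normc (u n w - l w)) (normc (fock_kernel z w))
          => a b.
        rewrite -subr_ge0; have -> : t^-1 / 2 * a ^+ 2 + t / 2 * b ^+ 2 - a * b =
          t^-1 / 2 * (a - t * b) ^+ 2.
          by field; rewrite gt_eqF.
        by apply: mulr_ge0 (sqr_ge0 _); rewrite divr_ge0// invr_ge0 ltW.
    rewrite RintegralD//; [|exact: iZ|exact: iZ].
    rewrite !RintegralZl// BK.
    have h : t^-1 * \int[@area R]_w A w <= t.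
      rewrite ler_pdivrMl// (le_trans Ar)// -expr2 ler_pXn2r ?nnegrE ?rate_ge0 ?ltW//.
    by move: h; move: (\int[_]_w A w) => x h; lra.
  have [N NP] := lP z t t0.
  have h1 := NP _ (leq_maxr n N).
  have h2 : normc (u (maxn n N) z - u n z) <= t * K.
    rewrite -fockBE (le_trans (normc_fock_le _ _))// ler_wpM2r//.
    by apply: le_trans (ltW rn); apply: u_cauchy; exact: leq_maxl.
  have -> : l z - bargmann l z =
    (l z - u (maxn n N) z) + (u (maxn n N) z - u n z) + cintegral (@area R) P.
    by rewrite E; ring.
  apply: le_trans (normcD _ _) _; apply: le_trans (lerD (normcD _ _) bP) _.
  rewrite normc_subC in h1.
  have et : e = 3 * (1 + K ^+ 2) * t by rewrite mulrC divfK// gt_eqF.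
  rewrite et; have := sqr_ge0 (K - 1); have := mulr_ge0 (ltW t0) K0 => g1 g2.
  by move: h1 h2 g1; have := mulr_ge0 (ltW t0) g2; nra.
have le : entire l.
  by have := entire_bargmann ml l2; congr entire; apply/funext => z; rewrite -lE.
have lf : l \in @in_fock R by apply/asboolP.
exists (Fock lf) => n; apply: fock_norm_le; first exact: rate_ge0.
exact: ul.
Qed.

End limit.

End fock_complete.

(** * The Toeplitz form *)

Section kernel_span.
Variable R : realType.
Implicit Types (f g v : fock R) (z w : R[i]).

Definition span_fock : set (fock R) := [set f | kernel_span f].

Lemma kernel_span_ind (P : fock R -> Prop) : P 0 ->
  (forall a z g, P g -> P (a *: kernel_fock z + g)) -> forall g, span_fock g -> P g.
Proof.
move=> P0 PS g [s gs].
have -> : g = \sum_(p <- s) p.1 *: kernel_fock p.2.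
  apply: fock_ext => w; rewrite gs; elim: s {gs} => [|p s IH];
    first by rewrite !big_nil.
  by rewrite !big_cons fockE -IH.
by elim: s {gs} => [|p s IH]; rewrite ?big_nil// big_cons; exact: PS.
Qed.

Lemma span_fock0 : span_fock 0.
Proof. by exists [::]; apply/funext => w; rewrite big_nil. Qed.

Lemma span_fock_linear a f g : span_fock f -> span_fock g -> span_fock (a *: f + g).
Proof.
move=> [s fs] [t gt]; exists ([seq (a * p.1, p.2) | p <- s] ++ t).
apply/funext => w; rewrite big_cat big_map fockE fs gt mulr_sumr; congr (_ + _).
by apply: eq_bigr => p _; rewrite mulrA.
Qed.

Lemma span_fockB f g : span_fock f -> span_fock g -> span_fock (f - g).
Proof. by move=> sf sg; rewrite addrC -scaleN1r; exact: span_fock_linear. Qed.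

Lemma span_fock_kernel z : span_fock (kernel_fock z).
Proof.
by exists [:: (1, z)]; apply/funext => w; rewrite big_seq1 mul1r.
Qed.

(** An element orthogonal to every kernel vanishes at every point by the reproducing formula. *)
Lemma span_fock_dense : dense_set (@fock_inner R) span_fock.
Proof.
apply: (dense_of_orthogonal (@fock_inner_linear R) (@fock_inner_conj R)
  (@fock_inner_ge0 R) (@fock_norm_eq0 R) (@fock_limit R) span_fock0 span_fock_linear).
move=> f fo; apply: fock_ext => z.
by rewrite -fock_reproducing fo//; exact: span_fock_kernel.
Qed.

Lemma fock_inner_antilinear a f g h : fock_inner h (a *: f + g) =
  a^* * fock_inner h f + fock_inner h g.
Proof. exact: (ip_antilinear (@fock_inner_linear R) (@fock_inner_conj R)). Qed.

End kernel_span.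

(** Arithmetic of [toeplitz_form_le]: [x] is the mu-integral of [f], [t] and [tv] are the forms at
    [f] and [v n], [r] is 1/(n+1) and [m] is |M|. The bound [r <= 1] turns the square of [r] into
    [r], whence the factor [1 + 8 * m]. *)
Lemma form_bound_arith (R : realType) (x e t tv r m : R) :
  0 <= m -> r <= 1 -> 0 < r -> (1 + 8 * m) * r < e ->
  2 * tv <= 2 * x + 2 * (2 * (m * (2 * r) ^+ 2)) -> t - tv < r -> t <= x + e.
Proof.
move=> m0 r1 r0 re h h'.
have : m * (2 * r) ^+ 2 <= 4 * (m * r).
  have -> : m * (2 * r) ^+ 2 = 4 * (m * r) * r by ring.
  by rewrite ler_piMr// mulr_ge0// mulr_ge0// ltW.
move: (m * (2 * r) ^+ 2) h => y h hy.
have {}re : r + 8 * (m * r) < e.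
  by have <- : (1 + 8 * m) * r = r + 8 * (m * r) by ring.
by move: (m * r) hy re => w; lra.
Qed.

Section toeplitz_form.
Variables (R : realType) (mu : {measure set R[i] -> \bar R}).
Hypothesis mu_M : condition_M mu.
Variable T : {linear fock R -> fock R}.
Hypothesis T_ext : toeplitz_extension mu T.
Implicit Types (f g v : fock R) (z w : R[i]).

Let mG := @measurable_gauss R.
Let G0 := @gauss_ge0 R.

Lemma span_gauss_sqint f : span_fock f -> (gauss_sqint mu f < +oo)%E.
Proof.
move: f; apply: kernel_span_ind => [|a z g IH]; rewrite /gauss_sqint.
  by under eq_integral do rewrite normc0 expr0n mul0r; rewrite integral0 ltry.
(* With [g] as reference function the difference is a single scaled kernel, to which condition (M)
   applies. *)
apply: le_lt_trans (le_sqint_split mu mG G0 (measurable_fock g) (measurable_fock _)) _.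
apply: lte_add_pinfty; apply: lte_mul_pinfty; rewrite ?lee_fin//.
have E w : (normc (g w - (a *: kernel_fock z + g) w) ^+ 2 * gauss w)%:E =
    ((normc a ^+ 2)%:E * (normc (fock_kernel z w) ^+ 2 * gauss w)%:E)%E.
  by rewrite fockE opprD addrC subrK normcN normcM exprMn -mulrA EFinM.
under eq_integral do rewrite E.
rewrite ge0_integralZl//.
- by apply: lte_mul_pinfty; rewrite ?lee_fin ?sqr_ge0//; exact: mu_M.
- by apply: measurable_sqW => //; exact: (measurable_fock (kernel_fock z)).
- by move=> w _; rewrite lee_fin; exact: mulr_ge0 (sqr_ge0 _) (G0 _).
- by rewrite lee_fin sqr_ge0.
Qed.

Lemma cintegrable_span f g : span_fock f -> span_fock g ->
  cintegrable mu (fun w => f w * (g w)^* * (gauss w)%:C).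
Proof.
by move=> sf sg; apply: cintegrable_prod => //; do ?exact: measurable_fock;
  exact: span_gauss_sqint.
Qed.

(* On the span, [<T f, K_z> = T f z] is the defining integral of the Toeplitz
   operator, and both sides are antilinear in [g]. *)
Lemma toeplitz_form f g : span_fock f -> span_fock g ->
  fock_inner (T f) g = 2^-1 * cintegral mu (fun w => f w * (g w)^* * (gauss w)%:C).
Proof.
move=> sf sg.
(* Membership in the span travels through the induction because additivity of the integral needs
   integrability against [g]. *)
suff [] : span_fock g /\ fock_inner (T f) g =
  2^-1 * cintegral mu (fun w => f w * (g w)^* * (gauss w)%:C) by [].
move: g sg; apply: kernel_span_ind => [|a z g [sg IH]].
  split; first exact: span_fock0.
  rewrite (ip0r (@fock_inner_linear R) (@fock_inner_conj R)).
  rewrite (eq_cintegral mu (g := fun=> 0)); last by move=> w;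
    rewrite fock0E rmorph0 mulr0 mul0r.
  by rewrite /cintegral !Rintegral_cst//= !mul0r mulr0.
have sk := span_fock_kernel z.
split; first exact: span_fock_linear.
rewrite fock_inner_antilinear IH fock_reproducing (T_ext sf) /toeplitz.
rewrite mulrCA -mulrDr; congr (_ * _).
have E w : f w * cexp (z * w^* / 2) * (gauss w)%:C =
  f w * (kernel_fock z w)^* * (gauss w)%:C.
  by rewrite -conj_fock_kernel.
rewrite (eq_cintegral _ E) -cintegralZ; last exact: cintegrable_span.
rewrite -cintegralD; [|exact/cintegrableZ/cintegrable_span|exact: cintegrable_span].
by apply: eq_cintegral => w; rewrite fockE rmorphD rmorphM /=; ring.
Qed.

Lemma toeplitz_form_sqr f : span_fock f ->
  fock_inner (T f) f = (2^-1 * \int[mu]_w (normc (f w) ^+ 2 * gauss w))%:C.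
Proof.
by move=> sf; rewrite toeplitz_form// cintegral_sqW rmorphM fmorphV rmorph_nat.
Qed.

Lemma toeplitz_form_ge0 f : span_fock f -> 0 <= fock_inner (T f) f.
Proof.
move=> sf; rewrite toeplitz_form_sqr// lecR mulr_ge0//; apply: Rintegral_ge0 => w _.
exact: mulr_ge0 (sqr_ge0 _) (G0 _).
Qed.

Lemma gauss_sqint_span f : span_fock f ->
  gauss_sqint mu f = (2 * Re (fock_inner (T f) f))%:E.
Proof.
have ReC (x : R) : Re x%:C = x by [].
move=> sf; rewrite toeplitz_form_sqr// ReC.
rewrite mulrA divff// mul1r /Rintegral fineK//; apply: integrable_fin_num => //.
apply: integrable_sqW => //; first exact: measurable_fock.
exact: span_gauss_sqint.
Qed.

Lemma gauss_sqint_area f : gauss_sqint (@area R) f = (2 * fock_norm f ^+ 2)%:E.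
Proof.
rewrite EFinM -fock_norm_integral -ge0_integralZl//.
- by apply: eq_integral => w _; rewrite -EFinM /fock_weight; congr (_%:E); field.
- by apply: measurable_sqW; [exact: measurable_fock_weight|exact: measurable_fock].
- by move=> w _; rewrite lee_fin; exact: mulr_ge0 (sqr_ge0 _) (fock_weight_ge0 _).
Qed.

Variable M : R.
Hypothesis T_bounded : forall f, fock_norm (T f) <= M * fock_norm f.

Lemma T_linear a f g : T (a *: f + g) = a *: T f + T g.
Proof. exact: linearP. Qed.

Lemma toeplitz_approx f (e : R) : 0 < e -> exists v, [/\ span_fock v,
  fock_norm (f - v) < e & normc (fock_inner (T f) f - fock_inner (T v) v) < e].
Proof.
exact: (form_approx (@fock_inner_linear R) (@fock_inner_conj R) (@fock_inner_ge0 R)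
  T_linear T_bounded (@span_fock_dense R)).
Qed.

Lemma toeplitz_positive f : 0 <= fock_inner (T f) f.
Proof.
have re e : 0 < e -> - e <= Re (fock_inner (T f) f) /\ `|Im (fock_inner (T f) f)| <= e.
  move=> e0; have [v [sv _ h]] := toeplitz_approx f e0.
  have := toeplitz_form_ge0 sv; move: h.
  case: (fock_inner (T f) f) (fock_inner (T v) v) => [a b] [c d] h.
  rewrite lecE /= => /andP[/eqP d0 c0].
  have := le_lt_trans (ler_Re_normc _) h; have := le_lt_trans (ler_Im_normc _) h.
  rewrite /= d0 oppr0 addr0 => /ltW h1; rewrite ltr_norml => /andP[h2 _].
  by split => //; lra.
rewrite lecE; apply/andP; split.
  rewrite -normr_le0; apply/ler_addgt0Pl => e e0; rewrite addr0.
  by have [_] := re e e0.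
rewrite /=; apply/ler_addgt0Pl => e e0.
by have [h _] := re e e0; rewrite /= in h *; lra.
Qed.

(* Fatou along kernel combinations [v n] tending to [f]: the [v n] are Cauchy in
   L^2(mu) because the mu-norm on the span is the form of the bounded [T]. *)
Lemma toeplitz_form_le f : ((Re (fock_inner (T f) f))%:E <= gauss_sqint mu f)%E.
Proof.
have : (0 <= gauss_sqint mu f)%E.
  by apply: integral_ge0 => w _; rewrite lee_fin; exact: mulr_ge0 (sqr_ge0 _) (G0 _).
case qE : (gauss_sqint mu f) => [x||]; [|by move=> _; rewrite leey|by []]. 
rewrite !lee_fin => x0.
have /choice[v vP] (n : nat) : exists v, [/\ span_fock v, fock_norm (f - v) <
  n.+1%:R^-1 &
    normc (fock_inner (T f) f - fock_inner (T v) v) < n.+1%:R^-1].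
  by apply: toeplitz_approx; rewrite invr_gt0.
have vlim w : cconv (fun n => v n w) (f w).
  move=> e e0; set K := fock_norm (kernel_fock w).
  have K0 : 0 <= K by exact: fock_norm_ge0.
  have [N NP] := small_harmonic K0 e0; exists N => m Nm.
  rewrite normc_subC -fockBE; apply: le_lt_trans (normc_fock_le _ _) _.
  apply: le_lt_trans NP; rewrite mulrC ler_wpM2l//.
  have [_ /ltW h _] := vP m; apply: le_trans h _.
  by rewrite lef_pV2 ?posrE// ler_nat.
pose M1 := `|M|.
have M10 : 0 <= M1 by exact: normr_ge0.
have dist n : (\int[mu]_w (normc (v n w - f w) ^+ 2 * gauss w)%:E <=
    (2 * (M1 * (2 / n.+1%:R) ^+ 2))%:E)%E.
  apply: (@fatou_sqint _ _ _ mu _ (fun m => v m) (v n) f n _ mG G0 _ vlim) => [m|m nm].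
    by apply: measurable_funBC; exact: measurable_fock.
  have [sn hn _] := vP n; have [sm hm _] := vP m.
  under eq_integral do rewrite -fockBE.
  rewrite -[X in (X <= _)%E]/(gauss_sqint mu (v n - v m)) gauss_sqint_span;
    last exact: span_fockB.
  rewrite lee_fin ler_wpM2l//; apply: le_trans (ler_norm _) _.
  apply: le_trans (ler_Re_normc _) _; apply: le_trans (fock_cauchy_schwarz _ _) _.
  have d0 := fock_norm_ge0 (v n - v m).
  apply: (@le_trans _ _ (M1 * fock_norm (v n - v m) * fock_norm (v n - v m))).
    by apply: ler_wpM2r => //; apply: le_trans (T_bounded _) _;
      rewrite ler_wpM2r// ler_norm.
  rewrite -mulrA -expr2 ler_wpM2l// ler_pXn2r ?nnegrE ?divr_ge0//.
  apply: le_trans (nrm_triangle (@fock_inner_linear R) (@fock_inner_conj R)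
    (@fock_inner_ge0 R) f _ _) _.
  rewrite (nrm_subC (@fock_inner_linear R) (@fock_inner_conj R)) -!/(fock_norm _).
  have mn : m.+1%:R^-1 <= n.+1%:R^-1 :> R by rewrite lef_pV2 ?posrE// ler_nat.
  move: hn hm mn; move: (fock_norm (f - v n)) (fock_norm (f - v m)) (n.+1%:R^-1)
    (m.+1%:R^-1).
  by move=> a b r s ha hb rs; rewrite mulr_natl mulr2n lerD ?(ltW ha)// (le_trans
    (ltW hb)).
have c0 : 0 <= 1 + 8 * M1 by rewrite addr_ge0// mulr_ge0.
apply/ler_addgt0Pr => e e0; have [n ne] := small_harmonic c0 e0.
have [sn _ hn] := vP n.
(* The factor 2 lost here cancels against the one in [gauss_sqint_span], which is why the lemma has
   constant 1. *)
have := le_sqint_split mu mG G0 (measurable_fock f) (measurable_fock (v n)).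
rewrite -/(gauss_sqint mu (v n)) -/(gauss_sqint mu f) qE gauss_sqint_span//.
under eq_integral do rewrite normc_subC.
have h20 : (0 <= 2%:E :> \bar R)%E by rewrite lee_fin.
move=> /le_trans/(_ (leeD2l _ (lee_wpmul2l h20 (dist n)))).
rewrite -!EFinM -EFinD lee_fin => h1.
have h2 : Re (fock_inner (T f) f) - Re (fock_inner (T (v n)) (v n)) < n.+1%:R^-1.
  apply: le_lt_trans hn; apply: le_trans (ler_norm _) _;
    apply: le_trans (ler_Re_normc _).
  by case: (fock_inner _ _) (fock_inner _ _) => [? ?] [? ?].
have n1 : n.+1%:R^-1 <= 1 :> R by rewrite invf_le1 ?ltr0n// ler1n.
have n0 : 0 < n.+1%:R^-1 :> R by rewrite invr_gt0.
exact: form_bound_arith M10 n1 n0 ne h1 h2.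
Qed.

End toeplitz_form.

(** * Invertibility and the reverse Carleson inequality *)

Section invertibility.
Variables (R : realType) (mu : {measure set R[i] -> \bar R}).
Hypothesis mu_M : condition_M mu.
Variable T : {linear fock R -> fock R}.
Hypothesis T_ext : toeplitz_extension mu T.
Variable M : R.
Hypothesis T_bounded : forall f, fock_norm (T f) <= M * fock_norm f.
Implicit Types (f g : fock R).

Lemma invertible_reverse_carleson : invertible_operator T -> reverse_carleson mu.
Proof.
move=> [S [[N SN] TS ST]].
pose M1 := `|M| + 1; pose N1 := `|N| + 1.
have M10 : 0 < M1 by rewrite ltr_wpDl.
have N10 : 0 < N1 by rewrite ltr_wpDl.
have TM1 f : fock_norm (T f) <= M1 * fock_norm f.
  by rewrite (le_trans (T_bounded f))// ler_wpM2r ?fock_norm_ge0// (le_trans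
    (ler_norm _))// lerDl.
have SN1 f : fock_norm (S f) <= N1 * fock_norm f.
  by rewrite (le_trans (SN f))// ler_wpM2r ?fock_norm_ge0// (le_trans (ler_norm
    _))// lerDl.
(* The constant comes from |f|^2 <= N1^2 |T f|^2 <= N1^2 M1 <T f, f>; the 2 is that of
   [gauss_sqint_area]. *)
have K0 : 0 < 2 * (N1 ^+ 2 * M1) by rewrite !mulr_gt0// exprn_gt0.
exists (2 * (N1 ^+ 2 * M1))^-1; first by rewrite invr_gt0.
move=> f; rewrite gauss_sqint_area.
apply: le_trans (toeplitz_form_le mu_M T_ext T_bounded f).
rewrite -EFinM lee_fin ler_pdivrMl//.
have h1 : fock_norm f ^+ 2 <= N1 ^+ 2 * fock_norm (T f) ^+ 2.
  rewrite -exprMn ler_pXn2r ?nnegrE ?mulr_ge0 ?fock_norm_ge0 ?(ltW N10)//.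
  by rewrite -{1}(TS f).
have h2 : fock_norm (T f) ^+ 2 <= M1 * Re (fock_inner (T f) f).
  exact: (positive_bound (@fock_inner_linear R) (@fock_inner_conj R) (@fock_inner_ge0 R)
    (@fock_norm_eq0 R) (T_linear T) TM1 (toeplitz_positive mu_M T_ext T_bounded)).
rewrite -[leRHS]mulrA; apply: ler_wpM2l => //; apply: le_trans h1 _.
by rewrite -[leRHS]mulrA; apply: ler_wpM2l => //; exact: sqr_ge0.
Qed.

(** The inequality is used on the span, where the mu-integral equals twice the form, and is carried
    to [f] by density. Off the span, [toeplitz_form_le] only bounds the mu-integral from below, the
    wrong way here. *)
Lemma reverse_carleson_coercive : reverse_carleson mu ->
  exists2 c : R, 0 < c & forall f, c * fock_norm f ^+ 2 <= Re (fock_inner (T f) f).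
Proof.
move=> [C C0 HC]; exists C => // f; rewrite leNgt; apply/negP => h.
set t := Re _ in h; set n := fock_norm f in h.
have n0 : 0 <= n by exact: fock_norm_ge0.
(* Approximation within [d] costs at most [d * (2 * C * n + 1)], which is half of the assumed defect
   [C * n ^+ 2 - t]. *)
pose d := (C * n ^+ 2 - t) / (2 * (2 * C * n + 1)).
have q0 : 0 < 2 * C * n + 1 by rewrite ltr_wpDl// mulr_ge0// mulr_ge0// ltW.
have d0 : 0 < d by rewrite divr_gt0 ?subr_gt0// mulr_gt0.
have [v [sv vn vt]] := toeplitz_approx T_bounded f d0.
have := HC v; rewrite gauss_sqint_area (gauss_sqint_span mu_M T_ext sv)
  -EFinM lee_fin => h1.
have h2 : Re (fock_inner (T v) v) - t < d.
  rewrite normc_subC in vt.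
  apply: le_lt_trans vt; apply: le_trans (ler_norm _) _;
    apply: le_trans (ler_Re_normc _).
  by rewrite /t; case: (fock_inner _ _) (fock_inner _ _) => [? ?] [? ?].
have h3 : n <= fock_norm v + d.
  have := nrmD (@fock_inner_linear R) (@fock_inner_conj R) (@fock_inner_ge0 R)
    (f - v) v.
  rewrite subrK -!/(fock_norm _) -/n => /le_trans; apply.
  by rewrite addrC lerD2l ltW.
have hd : d * (2 * (2 * C * n + 1)) = C * n ^+ 2 - t.
  by rewrite divfK// mulf_neq0// gt_eqF.
have v0 := fock_norm_ge0 v.
have final (m s : R) : 0 <= m -> n <= m + d -> C * (2 * m ^+ 2) <= 2 * s ->
  s - t < d -> False.
  move=> m0 nm hm hs.
  have : n ^+ 2 - 2 * d * n <= m ^+ 2.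
    have [dn|nd] := leP d n; last by have := sqr_ge0 m; nra.
    have : (n - d) ^+ 2 <= m ^+ 2 by rewrite ler_pXn2r ?nnegrE ?subr_ge0// lerBlDr.
    by have := sqr_ge0 d; rewrite sqrrB; lra.
  rewrite -(ler_pM2l C0) => hh.
  by have : d * (2 * (2 * C * n + 1)) = 4 * (C * (d * n)) + 2 * d by [ring]; lra.
exact: final v0 h3 h1 h2.
Qed.

Lemma reverse_carleson_invertible : reverse_carleson mu -> invertible_operator T.
Proof.
move=> /reverse_carleson_coercive[c c0 Tc].
have [low /choice[S TS]] := coercive_bijective (@fock_inner_linear R)
  (@fock_inner_conj R) (@fock_inner_ge0 R) (@fock_norm_eq0 R) (@fock_limit R)
  (T_linear T) T_bounded c0 Tc.
have Tinj : injective T.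
  move=> f g fg; apply/eqP; rewrite -subr_eq0; apply/eqP/fock_norm_eq0/eqP.
  rewrite eq_le fock_norm_ge0 andbT -(ler_pM2l c0) mulr0 (le_trans (low _))//.
  rewrite raddfB /= fg subrr -/(fock_norm 0) (_ : fock_norm _ = 0)//.
  by rewrite /fock_norm (ip0l (@fock_inner_linear R)) sqrtr0.
(* [S] is a pointwise choice of preimages; its linearity is forced by the injectivity of [T]. *)
have Slin : linear S.
  by move=> a f g; apply: Tinj; rewrite T_linear !TS.
pose S_linear := GRing.isLinear.Build R[i] (fock R) (fock R) *:%R S Slin.
pose S' : {linear fock R -> fock R} := HB.pack S S_linear.
exists S'; split.
- exists c^-1 => f; rewrite ler_pdivlMl//; apply: le_trans (low _) _.
  by rewrite /= TS.
- by move=> f; apply: Tinj; exact: TS.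
- by move=> f; exact: TS.
Qed.

End invertibility.

Theorem theorem4p4 (R : realType) (mu : {measure set R[i] -> \bar R})
    (mu_M : condition_M mu)
    (T_mu : {linear fock R -> fock R})
    (T_mu_toeplitz : toeplitz_extension mu T_mu)
    (T_mu_bounded : bounded_operator T_mu) :
  invertible_operator T_mu <-> reverse_carleson mu.
Proof.
have [M TM] := T_mu_bounded; split.
  exact: (@invertible_reverse_carleson R mu mu_M T_mu T_mu_toeplitz M TM).
exact: (@reverse_carleson_invertible R mu mu_M T_mu T_mu_toeplitz M TM).
Qed.
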